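(* Thompson's group $V$ embeds in (i.e. is isomorphic to a subgroup of) the mapping class group $\mathrm{MCG}(X)$ of the vertex shift $X$ defined by the matrix $$\begin{bmatrix} 1 & 1 & 0 \\ 1 & 1 & 1 \\ 1 & 1 & 1 \end{bmatrix}.$$
   Context: Thompson's group $V$ is the group (under composition) of homeomorphisms $f : \{0,1\}^{\mathbb N} \to \{0,1\}^{\mathbb N}$ such that for some $n \in \mathbb N$ there exists a function $F : \{0,1\}^n \to \{0,1\}^*$ such that $f(ux) = F(u)x$ for all $u \in \{0,1\}^n$, $x \in \{0,1\}^{\mathbb N}$. A subshift is a set of bi-infinite words over a finite alphabet defined by a set of forbidden finite words (equivalently, a closed shift-invariant set); $\sigma$ denotes the shift map, $\sigma(x)_i = x_{i+1}$. The vertex shift defined by a square $0$-$1$ matrix $M$ with rows and columns indexed by a finite set $S$ is the subshift of all $x \in S^{\mathbb Z}$ with $M(x_i,x_{i+1}) = 1$ for all $i\in\mathbb Z$. (For the matrix in the claim, indexing rows and columns by $0,1,2$ in this order, it is the subshift of $\{0,1,2\}^{\mathbb Z}$ with the single forbidden word $02$.) Mapping class group: let $X$ be a subshift. The mapping torus $\mathbf{S}X$ is the quotient space of $X \times \mathbb R$ by the equivalence relation $(x,t) \cong (\sigma^n(x), t-n)$ for $x \in X$, $t\in\mathbb R$, $n \in \mathbb Z$; write $[x,t]$ for the class of $(x,t)$. The path components of $\mathbf{S}X$ are the orbits of the $\mathbb R$-flow $r + [x,t] = [x,t+r]$, and self-homeomorphisms of $\mathbf{S}X$ map orbits onto orbits.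 Let $\mathcal F(X)$ be the group of self-homeomorphisms of $\mathbf{S}X$ which preserve the natural orientation of each orbit (the one given by the direction of the flow). Elements $f,g \in \mathcal F(X)$ are isotopic if there is a continuous map $h : [0,1]\times \mathbf{S}X \to \mathbf{S}X$ with $h(0,\cdot)=f$, $h(1,\cdot)=g$ and $h(t,\cdot) \in \mathcal F(X)$ for all $t\in[0,1]$. The mapping class group $\mathrm{MCG}(X)$ is the quotient of the group $\mathcal F(X)$ under isotopy. *)

(* Defs.v *)
From HB Require Import structures.
From mathcomp Require Import all_boot all_order all_algebra.
From mathcomp Require Import all_classical all_reals all_analysis.
From mathcomp Require Import lra.

Set Implicit Arguments.
Unset Strict Implicit.
Unset Printing Implicit Defensive.

Import Order.TTheory GRing.Theory Num.Theory.
Import numFieldNormedType.Exports.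

Local Open Scope classical_set_scope.
Local Open Scope ring_scope.

Record homeo (T : topologicalType) := Homeo {
  homeo_fun :> T -> T;
  homeo_inv : T -> T;
  homeo_continuous : continuous homeo_fun;
  homeo_inv_continuous : continuous homeo_inv;
  homeoK : cancel homeo_fun homeo_inv;
  homeoVK : cancel homeo_inv homeo_fun
}.

HB.instance Definition _ (T : topologicalType) := gen_eqMixin (homeo T).
HB.instance Definition _ (T : topologicalType) := gen_choiceMixin (homeo T).

Section HomeoGroup.
Variable T : topologicalType.
Implicit Types f g h : homeo T.

Lemma homeo_ext f g : f =1 g -> f = g.
Proof.
move=> fg; case: f g fg => [f f' cf cf' fK f'K] [g g' cg cg' gK g'K] /= fg.
have efg : f = g by exact/funext.
subst g; have ef'g' : f' = g' by apply/funext => x; rewrite -[in LHS](g'K x) fK.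
by subst g'; congr Homeo; exact: Prop_irrelevance.
Qed.

Lemma continuous_id_fun : continuous (@id T).
Proof. by move=> x; exact: cvg_id. Qed.

Lemma continuous_comp_fun (f g : T -> T) :
  continuous f -> continuous g -> continuous (f \o g).
Proof. by move=> cf cg x; apply: continuous_comp; [exact: cg|exact: cf]. Qed.

Definition homeo1 : homeo T :=
  @Homeo T id id continuous_id_fun continuous_id_fun
    (fun=> erefl) (fun=> erefl).

Definition homeoM f g : homeo T :=
  @Homeo T (f \o g) (homeo_inv g \o homeo_inv f)
    (continuous_comp_fun (@homeo_continuous _ f) (@homeo_continuous _ g))
    (continuous_comp_fun (@homeo_inv_continuous _ g)
       (@homeo_inv_continuous _ f))
    (can_comp (@homeoK _ f) (@homeoK _ g))
    (can_comp (@homeoVK _ g) (@homeoVK _ f)).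

Definition homeoV f : homeo T :=
  @Homeo T (homeo_inv f) f (@homeo_inv_continuous _ f)
    (@homeo_continuous _ f) (@homeoVK _ f) (@homeoK _ f).

Lemma homeoMA : associative homeoM.
Proof. by move=> f g h; exact: homeo_ext. Qed.
Lemma homeo1M : left_id homeo1 homeoM.
Proof. by move=> f; exact: homeo_ext. Qed.
Lemma homeoM1 : right_id homeo1 homeoM.
Proof. by move=> f; exact: homeo_ext. Qed.
Lemma homeoMV : left_inverse homeo1 homeoV homeoM.
Proof. by move=> f; apply: homeo_ext => x /=; exact: homeoK. Qed.
Lemma homeoMV' : right_inverse homeo1 homeoV homeoM.
Proof. by move=> f; apply: homeo_ext => x /=; exact: homeoVK. Qed.

HB.instance Definition _ :=
  isGroup.Build (homeo T) homeoMA homeo1M homeoM1 homeoMV homeoMV'.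

End HomeoGroup.

Definition prepend (u : seq bool) (x : cantor_space) : cantor_space :=
  fun i => if (i < size u)%N then nth false u i else x (i - size u)%N.

Definition prefix_exchange (f : cantor_space -> cantor_space) : Prop :=
  exists (n : nat) (F : n.-tuple bool -> seq bool),
    forall (u : n.-tuple bool) (x : cantor_space),
      f (prepend u x) = prepend (F u) x.

Definition thompsonV_pred : {pred homeo cantor_space} :=
  fun f => `[< prefix_exchange f >].

Definition thompsonV : Type := {f : homeo cantor_space | thompsonV_pred f}.

Lemma prepend_cat u v x : prepend (u ++ v) x = prepend u (prepend v x).
Proof.
apply/funext => i; rewrite /prepend size_cat nth_cat.
case: (ltnP i (size u)) => [iu|ui]; first by rewrite ltn_addr.
by rewrite ltn_subLR// subnDA.
Qed.

Lemma prepend_inj u v x y : size u = size v -> prepend u x = prepend v y -> u = v.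
Proof.
move=> suv e; apply: (@eq_from_nth _ false) => // i iu.
by have := congr1 (fun z : nat -> bool => z i) e; rewrite /prepend iu -suv iu.
Qed.

Lemma prepend_take (n : nat) (x : cantor_space) :
  prepend (mkseq x n) (fun i => x (n + i)%N) = x.
Proof.
apply/funext => i; rewrite /prepend size_mkseq.
by case: ltnP => ni; [rewrite nth_mkseq|rewrite subnKC].
Qed.

Lemma prefix_exchangeP (f : cantor_space -> cantor_space) (N : nat) :
  (forall w, size w = N ->
     exists v, forall x, f (prepend w x) = prepend v x) ->
  prefix_exchange f.
Proof.
move=> H; pose F (w : N.-tuple bool) := projT1 (cid (H w (size_tuple w))).
by exists N, F => u x; rewrite /F; case: cid.
Qed.

Lemma thompsonV_closed : group_closed thompsonV_pred.
Proof.
split; first by apply/asboolP; exists 0%N, (fun u => tval u).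
move=> f g /asboolP [n [F HF]] /asboolP [m [G HG]]; apply/asboolP.
pose N := \max_(u : m.-tuple bool) size (G u).
apply: (@prefix_exchangeP _ (N + n)) => w sw.
pose z := homeo_inv g (prepend w (fun=> false)).
have gz : g z = prepend w (fun=> false) by rewrite /z homeoVK.
pose u : m.-tuple bool := Tuple (introT eqP (size_mkseq z m)).
pose y : cantor_space := fun i => z (m + i)%N.
have zE : prepend u y = z by exact: prepend_take.
pose l := size (G u).
have lN : (l <= N)%N by exact: (leq_bigmax u).
have wE : take l w ++ drop l w = w by rewrite cat_take_drop.
have Gu : G u = take l w.
  apply: (@prepend_inj _ _ y (prepend (drop l w) (fun=> false))).
    by rewrite size_takel// sw (leq_trans lN)// leq_addr.
  by rewrite -HG zE gz -prepend_cat wE.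
have gV x : homeo_inv g (prepend w x) = prepend (u ++ drop l w) x.
  by rewrite -{1}wE -Gu prepend_cat -HG homeoK prepend_cat.
have sn : (n <= size (u ++ drop l w))%N.
  rewrite size_cat size_drop sw (leq_trans _ (leq_addl _ _))//.
  by rewrite -addnBAC// leq_addl.
have st : size (take n (u ++ drop l w)) == n by rewrite size_takel.
exists (F (Tuple st) ++ drop n (u ++ drop l w)) => x.
rewrite prepend_cat -HF /= -prepend_cat cat_take_drop.
by rewrite -gV.
Qed.

HB.instance Definition _ := SubChoice.on thompsonV.
HB.instance Definition _ :=
  SubChoice_isSubGroup.Build (homeo cantor_space) thompsonV_pred thompsonV
    thompsonV_closed.

Definition full_shift (A : finType) : Type :=
  prod_topology (fun _ : int => discrete_topology A).

HB.instance Definition _ (A : finType) := Topological.on (full_shift A).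

Definition avoiding (A : finType) (F : set (seq A)) : set (full_shift A) :=
  [set x | forall (w : seq A) (i : int),
     F w -> mkseq (fun k => x (i + k%:Z)) (size w) <> w].

Record subshift (A : finType) := Subshift {
  subshift_set :> set (full_shift A);
  subshift_avoiding : exists F : set (seq A), subshift_set = avoiding F
}.

(* The n-th iterate, n in Z, of the shift map x |-> (x_(i+1))_i. *)
Definition shiftz (A : finType) (n : int) (x : full_shift A) : full_shift A :=
  fun i => x (i + n).

Section VertexShift.
Variables (k : nat) (M : 'M[nat]_k).

Definition vertex_shift_set : set (full_shift 'I_k) :=
  [set x | forall i : int, M (x i) (x (i + 1)) = 1%N].

Lemma vertex_shift_avoiding : exists F, vertex_shift_set = avoiding F.
Proof.
exists [set w | exists a b, M a b <> 1%N /\ w = [:: a; b]].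
apply/seteqP; split => x /= xM.
  move=> w i [a [b [Mab ->]]] /=; rewrite /mkseq/= addr0 => -[xa xb].
  by apply: Mab; rewrite -xa -xb.
move=> i; apply: contrapT => nM.
apply: (xM [:: x i; x (i + 1)] i); first by exists (x i), (x (i + 1)).
by rewrite /mkseq/= addr0.
Qed.

Definition vertex_shift : subshift 'I_k := Subshift vertex_shift_avoiding.

End VertexShift.

Section MappingTorus.
Variables (R : realType) (A : finType) (X : subshift A).

Definition torus_rel : rel (set_type X * R) := fun p q =>
  `[< exists n : int,
        set_val q.1 = shiftz n (set_val p.1) /\ q.2 = p.2 - n%:~R >].

Lemma torus_rel_refl : reflexive torus_rel.
Proof.
move=> p; apply/asboolP; exists 0; split; last by rewrite subr0.
by apply/funext => i; rewrite /shiftz addr0.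
Qed.

Lemma torus_rel_sym : symmetric torus_rel.
Proof.
suff S p q : torus_rel p q -> torus_rel q p by move=> p q; apply/idP/idP; apply: S.
move=> /asboolP [n [e1 e2]]; apply/asboolP; exists (- n); split.
  by rewrite e1; apply/funext => i; rewrite /shiftz subrK.
by rewrite e2 rmorphN/= opprK subrK.
Qed.

Lemma torus_rel_trans : transitive torus_rel.
Proof.
move=> q p r /asboolP [n [e1 e2]] /asboolP [m [e3 e4]].
apply/asboolP; exists (m + n); split.
  by rewrite e3 e1; apply/funext => i; rewrite /shiftz addrA.
by rewrite e4 e2 rmorphD/= opprD addrA addrAC.
Qed.

Definition torus_equiv : equiv_rel (set_type X * R) :=
  EquivRel torus_rel torus_rel_refl torus_rel_sym torus_rel_trans.

Definition mapping_torus : Type :=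
  quotient_topology {eq_quot torus_equiv}%qT.

HB.instance Definition _ := Topological.on mapping_torus.
HB.instance Definition _ := Quotient.on mapping_torus.

Definition torus_class (x : set_type X) (t : R) : mapping_torus :=
  (\pi_mapping_torus (x, t))%qT.

Definition flow (r : R) (p : mapping_torus) : mapping_torus :=
  torus_class (repr p).1 ((repr p).2 + r).

Lemma torus_classP x t y s :
  torus_class x t = torus_class y s <->
  exists n : int, set_val y = shiftz n (set_val x) /\ s = t - n%:~R.
Proof.
split.
  move=> /(@eqmodP _ torus_equiv)/=.
  by move=> /asboolP.
by move=> H; apply/(@eqmodP _ torus_equiv)/asboolP.
Qed.

Lemma torus_class_repr p : torus_class (repr p).1 (repr p).2 = p.
Proof. by rewrite /torus_class -surjective_pairing reprK. Qed.

Lemma flowE r x t : flow r (torus_class x t) = torus_class x (t + r).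
Proof.
rewrite /flow; set p := repr _.
have /torus_classP [n [e1 e2]] : torus_class p.1 p.2 = torus_class x t.
  exact: torus_class_repr.
by apply/torus_classP; exists n; split => //; rewrite e2 addrAC.
Qed.

(* An oriented orbit is the line or the circle, parametrised by r |-> r + p;
   both cases are covered by lifting to the line.
   The parametrised orbit r |-> r + p is sent to the parametrised orbit
   of f p through an increasing homeomorphism of the line. *)
Definition orientation_preserving (f : mapping_torus -> mapping_torus) : Prop :=
  forall p, exists a : homeo R,
    {mono a : r s / r <= s} /\ forall r, f (flow r p) = flow (a r) (f p).

Definition Fgroup_pred : {pred homeo mapping_torus} :=
  fun f => `[< orientation_preserving f >].

Definition Fgroup : Type := {f : homeo mapping_torus | Fgroup_pred f}.

Lemma Fgroup_closed : group_closed Fgroup_pred.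
Proof.
split.
  by apply/asboolP => p; exists 1%g; split.
move=> f g /asboolP fo /asboolP go; apply/asboolP => p /=.
have [a [ha Ha]] := go (homeo_inv g p).
have [b [hb Hb]] := fo (homeo_inv g p).
exists (b * a^-1)%g; split => [r s|r] /=.
  by rewrite hb -ha !homeoVK.
rewrite -Hb; congr (f _).
by rewrite -[RHS](homeoK g) Ha !homeoVK.
Qed.

HB.instance Definition _ := SubChoice.on Fgroup.
HB.instance Definition _ :=
  SubChoice_isSubGroup.Build (homeo mapping_torus) Fgroup_pred Fgroup
    Fgroup_closed.

Definition cylinder : set (R * mapping_torus) := `[0, 1] `*` setT.

Definition isotopic (f g : Fgroup) : Prop :=
  exists h : R * mapping_torus -> mapping_torus,
    [/\ {within cylinder, continuous h},
        forall p, h (0, p) = val f p,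
        forall p, h (1, p) = val g p &
        forall t, t \in `[0, 1] ->
          exists k : Fgroup, forall p, h (t, p) = val k p].

Lemma within_comp (S T U : topologicalType) (C : set S) (D : set T)
    (u : S -> T) (h : T -> U) :
  {within C, continuous u} -> (forall x, C x -> D (u x)) ->
  {within D, continuous h} -> {within C, continuous (h \o u)}.
Proof.
move=> /subspace_continuousP cu CD /subspace_continuousP ch.
apply/subspace_continuousP => x Cx B nB.
have := ch (u x) (CD x Cx) B nB; rewrite /nbhs/= /within/= => nD.
have := cu x Cx _ nD; rewrite /nbhs/= /within/= => nC.
by near=> y => Cy; apply: (near nC y) => //; exact: CD.
Unshelve. all: by end_near. Qed.

Lemma within_pair (S T U : topologicalType) (C : set S)
    (u : S -> T) (v : S -> U) :
  {within C, continuous u} -> {within C, continuous v} ->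
  {within C, continuous (fun x => (u x, v x))}.
Proof. by move=> cu cv x; apply: cvg_pair; [exact: cu|exact: cv]. Qed.

Lemma within_eq (S T : topologicalType) (C : set S) (u v : S -> T) :
  (forall x, C x -> u x = v x) ->
  {within C, continuous u} -> {within C, continuous v}.
Proof.
by move=> uv; apply: subspace_eq_continuous => x /set_mem; exact: uv.
Qed.

Lemma reparam_continuous (c : R -> R) :
  continuous c -> continuous (fun p : R * mapping_torus => (c p.1, p.2)).
Proof.
move=> cc p; apply: (@cvg_pair _ _ _ (nbhs p) (nbhs (c p.1)) (nbhs p.2) _ _ _ (fun q => c q.1) snd); last exact: cvg_snd.
by apply: (@cvg_comp _ _ _ fst c); [exact: cvg_fst|exact: cc].
Qed.

Lemma isotopic_refl f : isotopic f f.
Proof.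
exists (fun tp => val f tp.2); split => // [|t _]; last by exists f.
apply: continuous_subspaceT => tp.
by apply: (@cvg_comp _ _ _ snd (val f)); [exact: cvg_snd|exact: homeo_continuous].
Qed.

Lemma isotopic_sym f g : isotopic f g -> isotopic g f.
Proof.
move=> [h [ch h0 h1 hF]]; exists (h \o fun tp => (1 - tp.1, tp.2)); split.
- apply: within_comp ch; last first.
    by move=> [t p] [/= + _]; rewrite !in_itv/= => t01; split => //=; rewrite in_itv/=; lra.
  apply: continuous_subspaceT; apply: (@reparam_continuous (fun t => 1 - t)).
  by move=> t; apply: cvgB; [exact: cvg_cst|exact: cvg_id].
- by move=> p /=; rewrite subr0.
- by move=> p /=; rewrite subrr.
- move=> t t01 /=; apply: (hF (1 - t)).
  by move: t01; rewrite !in_itv/=; lra.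
Qed.

Lemma isotopic_trans f g k : isotopic f g -> isotopic g k -> isotopic f k.
Proof.
move=> [h [ch h0 h1 hF]] [l [cl l0 l1 lF]].
pose H := fun tp : R * mapping_torus =>
  if tp.1 <= 2^-1 then h (2 * tp.1, tp.2) else l (2 * tp.1 - 1, tp.2).
have closedC (a b : R) : closed (`[a, b] `*` [set: mapping_torus]).
  rewrite (_ : _ `*` _ = fst @^-1` `[a, b]); last first.
    by apply/seteqP; split => [[t p] [] //|[t p] /= ?]; split.
  apply: closed_comp => [x _|]; [exact: cvg_fst|exact: interval_closed].
exists H; split.
- rewrite /cylinder (_ : _ `*` _ = `[0, 2^-1] `*` setT `|` `[2^-1, 1] `*` setT); last first.
    apply/seteqP; split => [[t p] [/= + _]|[t p] [] [/= + _]]; rewrite !in_itv/=.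
    + move=> t01; case: (lerP t 2^-1) => ht; [left|right]; split => //=;
        lra.
    + by move=> ?; split => //=; lra.
    + by move=> ?; split => //=; lra.
  apply: withinU_continuous => //.
  + apply: (@within_eq _ _ _ (h \o fun tp => (2 * tp.1, tp.2))).
      by move=> [t p] [/= + _]; rewrite in_itv/= /H/= => /andP[_ ->].
    apply: within_comp ch; last first.
      by move=> [t p] [/= + _]; rewrite !in_itv/= => t01; split => //=; rewrite in_itv/=; lra.
    apply: continuous_subspaceT; apply: (@reparam_continuous (fun t => 2 * t)).
    by move=> t; apply: cvgM; [exact: cvg_cst|exact: cvg_id].
  + apply: (@within_eq _ _ _ (l \o fun tp => (2 * tp.1 - 1, tp.2))).
      move=> [t p] [/= + _]; rewrite in_itv/= /H/= => /andP[t2 _].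
      case: ifPn => // t2'; have -> : t = 2^-1 by apply/eqP; rewrite eq_le t2' t2.
      by rewrite divff// subrr l0 h1.
    apply: within_comp cl; last first.
      by move=> [t p] [/= + _]; rewrite !in_itv/= => t01; split => //=; rewrite in_itv/=; lra.
    apply: continuous_subspaceT; apply: (@reparam_continuous (fun t => 2 * t - 1)).
    move=> t; apply: cvgB; last exact: cvg_cst.
    by apply: cvgM; [exact: cvg_cst|exact: cvg_id].
- by move=> p; rewrite /H/= ifT ?mulr0 ?h0//; lra.
- move=> p; rewrite /H/= ifN; last by rewrite -ltNge; lra.
  by rewrite mulr1 (_ : 2 - 1 = 1)// ?l1//; lra.
- move=> t; rewrite in_itv/= => t01; rewrite /H/=; case: (lerP t 2^-1) => ht.
    by apply: (hF (2 * t)); rewrite in_itv/=; lra.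
  by apply: (lF (2 * t - 1)); rewrite in_itv/=; lra.
Qed.

Lemma isotopicM f f' g g' :
  isotopic f f' -> isotopic g g' -> isotopic (f * g)%g (f' * g')%g.
Proof.
move=> [h [ch h0 h1 hF]] [l [cl l0 l1 lF]].
exists (h \o fun tp => (tp.1, l tp)); split.
- apply: within_comp ch; last by move=> [t p] [].
  apply: within_pair => //.
  by apply: continuous_subspaceT => tp; exact: cvg_fst.
- by move=> p /=; rewrite l0 h0.
- by move=> p /=; rewrite l1 h1.
- move=> t t01; have [a Ha] := hF t t01; have [b Hb] := lF t t01.
  by exists (a * b)%g => p /=; rewrite Hb Ha.
Qed.

Definition isotopy_rel : rel Fgroup := fun f g => `[< isotopic f g >].

Lemma isotopy_rel_refl : reflexive isotopy_rel.
Proof. by move=> f; apply/asboolP; exact: isotopic_refl. Qed.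
Lemma isotopy_rel_sym : symmetric isotopy_rel.
Proof. by move=> f g; apply: asbool_equiv_eq; split; exact: isotopic_sym. Qed.
Lemma isotopy_rel_trans : transitive isotopy_rel.
Proof.
by move=> g f k /asboolP fg /asboolP gk; apply/asboolP; exact: isotopic_trans gk.
Qed.

Definition isotopy_equiv : equiv_rel Fgroup :=
  EquivRel isotopy_rel isotopy_rel_refl isotopy_rel_sym isotopy_rel_trans.

Definition MCG : Type := {eq_quot isotopy_equiv}%qT.

HB.instance Definition _ := Choice.on MCG.
HB.instance Definition _ := EqQuotient.on MCG.

Definition mapping_class (f : Fgroup) : MCG := (\pi_MCG f)%qT.

Lemma mapping_classP f g : mapping_class f = mapping_class g <-> isotopic f g.
Proof.
split; first by move=> /(@eqmodP _ isotopy_equiv)/= /asboolP.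
by move=> H; apply/(@eqmodP _ isotopy_equiv)/asboolP.
Qed.

Definition MCG_one : MCG := mapping_class 1%g.
Definition MCG_mul (a b : MCG) : MCG := mapping_class (repr a * repr b)%g.
Definition MCG_inv (a : MCG) : MCG := mapping_class (repr a)^-1%g.

Lemma mapping_class_repr a : mapping_class (repr a) = a.
Proof. exact: reprK. Qed.

Lemma MCG_mulE f g :
  MCG_mul (mapping_class f) (mapping_class g) = mapping_class (f * g)%g.
Proof.
by apply/mapping_classP/isotopicM; apply/mapping_classP; exact: mapping_class_repr.
Qed.

Lemma MCG_ind (P : MCG -> Prop) : (forall f, P (mapping_class f)) -> forall a, P a.
Proof. by move=> H a; rewrite -[a]mapping_class_repr. Qed.

Lemma MCG_mulA : associative MCG_mul.
Proof.
by elim/MCG_ind => f; elim/MCG_ind => g; elim/MCG_ind => k; rewrite !MCG_mulE mulgA.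
Qed.
Lemma MCG_mul1 : left_id MCG_one MCG_mul.
Proof. by elim/MCG_ind => f; rewrite MCG_mulE mul1g. Qed.
Lemma MCG_1mul : right_id MCG_one MCG_mul.
Proof. by elim/MCG_ind => f; rewrite MCG_mulE mulg1. Qed.
Lemma MCG_mulV : left_inverse MCG_one MCG_inv MCG_mul.
Proof. by move=> a; rewrite -{2}[a]mapping_class_repr MCG_mulE mulVg. Qed.
Lemma MCG_mulV' : right_inverse MCG_one MCG_inv MCG_mul.
Proof. by move=> a; rewrite -{1}[a]mapping_class_repr MCG_mulE mulgV. Qed.

HB.instance Definition _ :=
  isGroup.Build MCG MCG_mulA MCG_mul1 MCG_1mul MCG_mulV MCG_mulV'.

End MappingTorus.

Definition no02_matrix : 'M[nat]_3 :=
  \matrix_(i, j) nth 0%N (nth [::] [:: [:: 1; 1; 0];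
                                       [:: 1; 1; 1];
                                       [:: 1; 1; 1]]%N i) j.

(* Main.v *)
Require Import Defs.
From HB Require Import structures.
From mathcomp Require Import all_boot all_order all_algebra.
From mathcomp Require Import all_classical all_reals all_analysis.
From mathcomp Require Import zify lra.

(** The letter 2 is a marker. Since 02 is forbidden, the letters between two
    consecutive markers form a binary word that does not end in 0, and such
    words w correspond to the eventually zero sequences w000... An element f of
    Thompson's group exchanges a prefix, so it permutes the eventually zero
    sequences and thereby these words; it also acts on the infinite word that
    follows a last marker. Replace every word by its image and keep the letters
    before a first marker. This changes words only near their left ends and
    translates the rest, so it is a continuous operation on the orbits of the
    subshift, compatible with composition
    ([recode], [recode_comp], [recode_local]).

    To act on points of the mapping torus one also needs maps between flow
    lines. Careless choices would compose only up to isotopy; the following one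
    composes exactly. Let D(t) = min(2t, t + 1), which fixes 0 and is the
    translation by 1 on [1, +oo). The point at distance t after a marker goes to
    the point at distance D^c(t) after the image of the marker, where c is the
    change of length of the word that follows. If L and L + c are at least 1
    then D^c maps [0, L] onto [0, L + c], so that the segments of a flow line
    fit together; far from the marker D^c is the translation by c, so that the
    map is continuous even where the markers escape to minus infinity; and
    D^c D^d = D^(c + d), so that composition is respected ([retime],
    [retime_local], [retime_comp]). The result is an action of Thompson's group
    on the mapping torus by orientation preserving homeomorphisms ([act_mul],
    [act_orientation]); in particular continuity of the inverses is free.

    For injectivity, an isotopy moves each point along a path, and a path in the
    mapping torus stays in one orbit, because in a flow box its transversal
    coordinate is a continuous function from an interval to a totally
    disconnected space ([path_orbit]). Let f and g have isotopic images and let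
    z be any point of the Cantor space. The sequence ...111 2 z has one marker;
    it is sent to ...111 2 f(z) and to ...111 2 g(z). These lie in the same
    orbit, and the single marker forces them to be equal, so f(z) = g(z)
    ([isotopic_act_inj]). *)

Set Implicit Arguments.
Unset Strict Implicit.
Unset Printing Implicit Defensive.
Import Order.TTheory GRing.Theory Num.Theory.
Import numFieldNormedType.Exports.
Local Open Scope classical_set_scope.
Local Open Scope ring_scope.

(** * Markers *)

Definition bit (b : bool) : 'I_3 := inord b.

(** The letter 2 delimits words: it is the letter that cannot follow a 0. *)
Definition marked (x : int -> 'I_3) (i : int) : bool := x i == ord_max.

Lemma bit_neq_max b : (bit b == ord_max) = false.
Proof. by apply/eqP => /(congr1 val) /=; rewrite inordK; case: b. Qed.

Lemma bit_inj : injective bit.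
Proof. by move=> a b /(congr1 val) /=; rewrite !inordK; case: a; case: b. Qed.

Lemma letterE (a : 'I_3) : a != ord_max -> a = bit (a == bit true).
Proof.
have e0 : bit false = 0%N :> nat by rewrite inordK.
have e1 : bit true = 1%N :> nat by rewrite inordK.
move=> a2; case: eqP => // ab; apply/val_inj => /=; rewrite e0.
have : a != 1%N :> nat by apply: contra_notN ab => /eqP a1; apply/val_inj; rewrite /= e1.
by case: a a2 {ab} => -[|[|[|]]].
Qed.

Definition admissible (x : int -> 'I_3) :=
  forall i, x i = bit false -> ~~ marked x (i + 1).

Lemma vertex_shift_no02P (x : int -> 'I_3) :
  vertex_shift_set no02_matrix x <-> admissible x.
Proof.
have e0 : bit false = 0%N :> nat by rewrite inordK.
rewrite /vertex_shift_set/=; split => H i; have := H i; rewrite !mxE /marked.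
  move=> Hi xi; move: Hi; rewrite (_ : nat_of_ord (x i) = 0%N) ?xi//.
  by case: (x (i + 1)) => -[|[|[|]]].
move=> {}H; have := @letterE (x i); rewrite /marked in H.
case: (x i) H => -[|[|[|]]]//= p H _; case: (x (i + 1)) H => -[|[|[|]]]//= q H.
by have /H : Ordinal p = bit false by apply/val_inj; rewrite /= e0.
Qed.

(** * Words *)

Definition vanish (z : cantor_space) (l : nat) := forall i, (l <= i)%N -> z i = false.

(** A finite word that does not end in 0 is encoded by the eventually zero
    sequence obtained by padding it with zeros. This recovers its length; on
    sequences that are not eventually zero the value is the default 0. *)
Definition word_size (z : cantor_space) : nat :=
  xget 0%N [set l | vanish z l /\ (forall k, l = k.+1 -> z k)].

Lemma word_sizeE z l : vanish z l -> (forall k, l = k.+1 -> z k) -> word_size z = l.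
Proof.
move=> zl lz; rewrite /word_size; case: xgetP => [l' _ [zl' l'z]|/(_ l)]; last by case.
case: (ltngtP l l') => //.
  by case: l' zl' l'z => // k _ /(_ _ erefl) zk; rewrite ltnS => /zl; rewrite zk.
by case: l zl lz => // k _ /(_ _ erefl) zk; rewrite ltnS => /zl'; rewrite zk.
Qed.

Lemma word_sizeP z l : vanish z l ->
  vanish z (word_size z) /\ (forall k, word_size z = k.+1 -> z k).
Proof.
move=> zl; suff [l' [zl' l'z]] : exists l', vanish z l' /\ (forall k, l' = k.+1 -> z k).
  by rewrite (word_sizeE zl' l'z).
elim: l zl => [|l IH] zl; first by exists 0%N; split.
case zE : (z l); first by exists l.+1; split => // k [<-].
apply: IH => i; rewrite leq_eqVlt => /orP[/eqP <- //|]; exact: zl.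
Qed.

(** Padding with zeros from the next marker on turns finite and infinite words
    alike into points of the Cantor space, on which Thompson's group acts. *)
Definition word (x : int -> 'I_3) (m : int) : cantor_space :=
  fun i => (x (m + 1 + i%:Z) == bit true) && [forall k : 'I_i, ~~ marked x (m + 1 + k%:Z)].

Lemma word_letter (x : int -> 'I_3) (m : int) (i : nat) :
  (forall k, m < k -> k <= m + 1 + i%:Z -> ~~ marked x k) -> x (m + 1 + i%:Z) = bit (word x m i).
Proof.
move=> nx; rewrite /word (_ : [forall _, _] = true) ?andbT; last first.
  by apply/forallP => k; apply: nx; have := ltn_ord k; lia.
by apply: letterE; apply: nx; lia.
Qed.

Lemma word_ext x x' m m' (i : nat) :
  (forall k : nat, (k <= i)%N -> x (m + 1 + k%:Z) = x' (m' + 1 + k%:Z)) ->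
  word x m i = word x' m' i.
Proof.
move=> e; rewrite /word e//; congr (_ && _).
by apply: eq_forallb => k; rewrite /marked e// ltnW.
Qed.

Lemma word_vanish (x : int -> 'I_3) (m m' : int) : m < m' -> marked x m' ->
  vanish (word x m) (absz (m' - m - 1)%R).
Proof.
move=> mm' xm' i li; apply/negP => /andP[xi /forallP ni].
have := li; rewrite leq_eqVlt => /orP[/eqP E|E].
  move: xi xm'; rewrite /marked -E (_ : m + 1 + _ = m'); last by lia.
  by move=> /eqP ->; rewrite bit_neq_max.
have := ni (Ordinal E); rewrite /= (_ : m + 1 + _ = m'); last by lia.
by rewrite xm'.
Qed.

(** As 02 is forbidden, a nonempty word before a marker ends in 1, so that
    padding it loses nothing. *)
Lemma word_size_gap (x : int -> 'I_3) (m m' : int) : admissible x -> m < m' -> marked x m' ->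
  (forall k, m < k -> k < m' -> ~~ marked x k) ->
  (word_size (word x m))%:Z = m' - m - 1.
Proof.
move=> ax mm' xm' nx.
have -> : m' - m - 1 = (absz (m' - m - 1)%R)%:Z by lia.
congr Posz; apply: word_sizeE; first exact: word_vanish.
move=> k kE; apply: contraT => /negbTE wk.
have := @word_letter x m k; rewrite wk => H.
have := ax _ (H _); rewrite (_ : m + 1 + _ + 1 = m') ?xm' ?nx//; last by lia.
by apply => j mj jk; apply: nx => //; lia.
Qed.

Lemma wordE x m (z : cantor_space) :
  (forall i : nat, x (m + 1 + i%:Z) = bit (z i)) -> word x m = z.
Proof.
move=> H; apply/funext => i; apply: bit_inj; rewrite -H -word_letter// => k mk' _.
by rewrite /marked (_ : k = m + 1 + (absz (k - m - 1)%R)%:Z) ?H ?bit_neq_max//; lia.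
Qed.

Lemma wordE_fin x m (z : cantor_space) (l : nat) :
  (forall i : nat, (i < l)%N -> x (m + 1 + i%:Z) = bit (z i)) ->
  marked x (m + 1 + l%:Z) -> vanish z l -> word x m = z.
Proof.
move=> H xl zl; apply/funext => i; case: (ltnP i l) => il; last first.
  by rewrite zl// (@word_vanish x m (m + 1 + l%:Z))//; lia.
apply: bit_inj; rewrite -H// -word_letter// => k mk' ki.
by rewrite /marked (_ : k = m + 1 + (absz (k - m - 1)%R)%:Z) ?H ?bit_neq_max//; lia.
Qed.

(** * Neighbouring markers *)

Lemma next_marker (x : int -> 'I_3) (m m' : int) : m < m' -> marked x m' ->
  exists m2, [/\ m < m2, m2 <= m', marked x m2 & forall k, m < k -> k < m2 -> ~~ marked x k].
Proof.
move=> mm' xm'.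
have ex : exists k : nat, marked x (m + 1 + k%:Z).
  by exists (absz (m' - m - 1)%R); rewrite (_ : m + 1 + _ = m')//; lia.
case: (ex_minnP ex) => l xl lmin; exists (m + 1 + l%:Z); split => //; first by lia.
  rewrite leNgt; apply/negP => lt; have := lmin (absz (m' - m - 1)%R).
  by rewrite (_ : m + 1 + _ = m'); [move=> /(_ xm')|]; lia.
move=> k mk1 kl; apply/negP => xk; have := lmin (absz (k - m - 1)%R).
by rewrite (_ : m + 1 + _ = k); [move=> /(_ xk)|]; lia.
Qed.

Lemma prev_marker (x : int -> 'I_3) (m i : int) : m <= i -> marked x m ->
  exists m2, [/\ m <= m2, m2 <= i, marked x m2 & forall k, m2 < k -> k <= i -> ~~ marked x k].
Proof.
move=> mi xm.
have ex : exists k : nat, marked x (i - k%:Z).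
  by exists (absz (i - m)%R); rewrite (_ : i - _ = m)//; lia.
case: (ex_minnP ex) => l xl lmin; exists (i - l%:Z); split => //; last 2 first.
- by lia.
- move=> k mk1 kl; apply/negP => xk; have := lmin (absz (i - k)%R).
  by rewrite (_ : i - _ = k); [move=> /(_ xk)|]; lia.
rewrite leNgt; apply/negP => lt; have := lmin (absz (i - m)%R).
by rewrite (_ : i - _ = m); [move=> /(_ xm)|]; lia.
Qed.

Definition later_marker (x : int -> 'I_3) (m : int) : Prop := exists2 k, m < k & marked x k.

(** * Prefix exchanges *)

Definition agree (n : nat) (z z' : cantor_space) := forall i, (i < n)%N -> z i = z' i.

(** The prefix exchange table as a function G on whole sequences that depends
    only on their first n letters. *)
Definition prefix_rule (f : cantor_space -> cantor_space) (n : nat)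
    (G : cantor_space -> seq bool) :=
  (forall z z', agree n z z' -> G z = G z') /\
  (forall z, f z = prepend (G z) (fun i => z (n + i)%N)).

Lemma prefix_ruleP f : prefix_exchange f -> exists n G, prefix_rule f n G.
Proof.
move=> [n [F FE]].
exists n, (fun z => F (Tuple (introT eqP (size_mkseq z n)))); split => z.
  move=> z' zz'; congr F; apply/val_inj => /=.
  by apply: (@eq_from_nth _ false); rewrite ?size_mkseq// => i i_n; rewrite !nth_mkseq// zz'.
by rewrite -FE /= prepend_take.
Qed.

Definition germ_at (f : cantor_space -> cantor_space) (z : cantor_space) (a b : nat) :=
  forall z', agree a z' z -> agree b (f z') (f z) /\ forall i, f z' (b + i)%N = z' (a + i)%N.

(** The length change of f at z, defined without reference to a table: it is
    the difference of lengths of any prefix exchange that represents f near z. *)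
Definition germ (f : cantor_space -> cantor_space) (z : cantor_space) : int :=
  xget 0 [set c : int | exists a b, germ_at f z a b /\ c = b%:Z - a%:Z].

Lemma germ_at_add f z a b k : germ_at f z a b -> germ_at f z (a + k) (b + k).
Proof.
move=> H z' az'; have [|b1 b2] := H z'.
  by move=> i ia; apply: az'; rewrite ltn_addr.
split => [i ib|i]; last by rewrite -!addnA b2.
case: (ltnP i b) => [/b1//|bi].
rewrite -(subnKC bi) b2; have [|_ ->] := H z; first by [].
by apply: az'; lia.
Qed.

Arguments germ_at_add {f z a b} k _.

(** Two different lengths b < b' would let the letter of the input at index a
    reappear both as a free letter and as part of a constant prefix. *)
Lemma germ_at_uniq f z a b b' : germ_at f z a b -> germ_at f z a b' -> (b' <= b)%N.
Proof.
move=> H H'; rewrite leqNgt; apply/negP => bb'.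
(* flip the first letter after the prefix *)
pose z' : cantor_space := fun i => if i == a then ~~ z a else z i.
have az' : agree a z' z.
  by move=> i ia; rewrite /z' ifN//; apply: contraTneq ia => ->; rewrite ltnn.
have [_ /(_ 0%N) h1] := H _ az'; have [/(_ _ bb') h2 _] := H' _ az'.
have [//|_ /(_ 0%N) h3] := H z; rewrite !addn0 in h1 h3.
by have : z' a = z a by [rewrite -h1 h2 h3]; rewrite /z' eqxx; case: (z a).
Qed.

Lemma germE f z a b : germ_at f z a b -> germ f z = b%:Z - a%:Z.
Proof.
move=> H; rewrite /germ; case: xgetP => [c _ [a' [b' [H' ->]]]|/(_ (b%:Z - a%:Z))]; last first.
  by move=> /= N; exfalso; apply: N; exists a, b.
have h1 := germ_at_add a' H; have h2 := germ_at_add a H'.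
rewrite (addnC a') in h2; have := germ_at_uniq h1 h2; have := germ_at_uniq h2 h1; lia.
Qed.

Lemma germ_at_comp f g z a b c : germ_at g z a b -> germ_at f (g z) b c ->
  germ_at (f \o g) z a c.
Proof.
move=> H H' z' az'; have [g1 g2] := H _ az'; have [f1 f2] := H' _ g1.
by split => // i /=; rewrite f2 g2.
Qed.

Section PrefixExchange.
Variables (f : cantor_space -> cantor_space) (n : nat) (G : cantor_space -> seq bool).
Hypothesis Hf : prefix_rule f n G.

Lemma prefix_rule_head z i : (i < size (G z))%N -> f z i = nth false (G z) i.
Proof. by move=> iG; case: Hf => _ ->; rewrite /prepend iG. Qed.

Lemma prefix_rule_tail z i : f z (size (G z) + i)%N = z (n + i)%N.
Proof. by case: Hf => _ ->; rewrite /prepend ltnNge leq_addr/= addKn. Qed.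

Lemma prefix_rule_germ_at z : germ_at f z n (size (G z)).
Proof.
move=> z' zz'; have e : G z' = G z by case: Hf => H _; exact: H.
by split => [i iG|i]; [rewrite !prefix_rule_head ?e|rewrite -e prefix_rule_tail].
Qed.

Lemma prefix_rule_germ z : germ f z = (size (G z))%:Z - n%:Z.
Proof. exact: (germE (@prefix_rule_germ_at z)). Qed.

Lemma prefix_rule_agree z z' k : agree (n + k) z z' -> agree (size (G z) + k) (f z) (f z').
Proof.
move=> zz'; have e : G z = G z'.
  by case: Hf => H _; apply: H => i i_n; apply: zz'; rewrite ltn_addr.
move=> i; case: (ltnP i (size (G z))) => [iG _|Gi ik]; first by rewrite !prefix_rule_head -?e.
by rewrite -(subnKC Gi) prefix_rule_tail e prefix_rule_tail zz'// -e; lia.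
Qed.

Lemma prefix_rule_vanish z l : vanish z l -> vanish (f z) (size (G z) + l).
Proof. by move=> zl i il; rewrite -(@subnKC (size (G z)) i) ?prefix_rule_tail ?zl//; lia. Qed.

(** A final letter 1 beyond the exchanged prefix survives. For shorter words
    the new prefix may end in zeros, which the encoding drops, and no such
    formula holds. *)
Lemma prefix_rule_size z l : vanish z l -> (n < word_size z)%N ->
  (word_size (f z))%:Z = (word_size z)%:Z + (size (G z))%:Z - n%:Z.
Proof.
move=> /word_sizeP [zl lz] nl.
rewrite (@word_sizeE (f z) (size (G z) + (word_size z - n))%N); first by lia.
  by move=> i il; rewrite -(@subnKC (size (G z)) i) ?prefix_rule_tail ?zl//; lia.
move=> k kE; rewrite (_ : k = size (G z) + (word_size z - n).-1)%N; last by lia.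
by rewrite prefix_rule_tail; apply: lz; lia.
Qed.

End PrefixExchange.

(** How much longer a word becomes. For an infinite word this is the shift that
    f applies to its far part. Long finite words obey the formula of infinite
    ones (see gain_long), which is the source of all continuity below. *)
Definition gain (f : cantor_space -> cantor_space) (x : int -> 'I_3) (m : int) : int :=
  if `[<later_marker x m>] then (word_size (f (word x m)))%:Z - (word_size (word x m))%:Z
  else germ f (word x m).

Lemma germ_comp f g z : prefix_exchange f -> prefix_exchange g ->
  germ (f \o g) z = germ g z + germ f (g z).
Proof.
move=> /prefix_ruleP [n [F HF]] /prefix_ruleP [m [G HG]].
have hg := germ_at_add n (@prefix_rule_germ_at _ _ _ HG z).
have hf := germ_at_add (size (G z)) (@prefix_rule_germ_at _ _ _ HF (g z)).
rewrite addnC in hf.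
by rewrite (germE (germ_at_comp hg hf)) (germE hg) (germE hf); lia.
Qed.

Section Change.
Variables (f : cantor_space -> cantor_space) (n : nat) (G : cantor_space -> seq bool).
Hypothesis Hf : prefix_rule f n G.

Lemma gain_long (x : int -> 'I_3) (m : int) : admissible x ->
  (forall k, m < k -> k <= m + 1 + n%:Z -> ~~ marked x k) ->
  gain f x m = (size (G (word x m)))%:Z - n%:Z.
Proof.
move=> ax nx; rewrite /gain; case: asboolP => [[k mk1 xk]|_]; last exact: (prefix_rule_germ Hf).
have [m2 [mm2 m2k xm2 nm2]] := next_marker mk1 xk.
have wE := word_size_gap ax mm2 xm2 nm2.
have lt : m + 1 + n%:Z < m2.
  by rewrite ltNge; apply/negP => le; have := nx _ mm2 le; rewrite xm2.
rewrite (prefix_rule_size Hf (word_vanish mm2 xm2)); lia.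
Qed.

(** A bound independent of the sequence: it keeps markers that are far away
    from having any influence near the origin. *)
Lemma gain_ge x m : admissible x -> - n%:Z <= gain f x m.
Proof.
move=> ax; case: (pselect (exists k, [/\ m < k, k <= m + 1 + n%:Z & marked x k])).
  move=> [k [mk1 kn xk]]; have [m2 [mm2 m2k xm2 nm2]] := next_marker mk1 xk.
  have wE := word_size_gap ax mm2 xm2 nm2.
  rewrite /gain asboolT; last by exists k.
  by lia.
move=> N; rewrite gain_long//; first by lia.
by move=> k mk1 kn; apply/negP => xk; apply: N; exists k.
Qed.

(** Either the word ends inside the window and is known entirely, or it is long
    and gain_long applies. *)
Lemma gain_local (x x' : int -> 'I_3) (m : int) : admissible x -> admissible x' ->
  (forall k, m < k -> k <= m + 1 + n%:Z -> x k = x' k) ->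
  gain f x m = gain f x' m.
Proof.
move=> ax ax' e; case: (pselect (exists k, [/\ m < k, k <= m + 1 + n%:Z & marked x k])).
  move=> [k [mk1 kn xk]]; have [m2 [mm2 m2k xm2 nm2]] := next_marker mk1 xk.
  have xm2' : marked x' m2 by rewrite /marked -e//; lia.
  rewrite /gain !asboolT; [|by exists m2|by exists m2].
  suff -> : word x m = word x' m by [].
  apply/funext => i; case: (ltP (m + 1 + i%:Z) m2) => im2.
    by apply: word_ext => j ji; apply: e; lia.
  by rewrite !(word_vanish mm2)//; lia.
move=> N.
have nx k : m < k -> k <= m + 1 + n%:Z -> ~~ marked x k.
  by move=> mk1 kn; apply/negP => xk; apply: N; exists k.
rewrite !gain_long//; last by move=> k mk1 kn; rewrite /marked -e//; exact: nx.
suff -> : G (word x m) = G (word x' m) by [].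
case: Hf => H _; apply: H => i i_n; apply: word_ext => j ji; apply: e; lia.
Qed.

End Change.

(** * Positions *)

Lemma int_step_ind (P : int -> Prop) :
  P 0 -> (forall i, P i -> P (i + 1)) -> (forall i, P (i + 1) -> P i) -> forall i, P i.
Proof.
move=> P0 Pp Pm; elim/int_rect => [//|n IH|n IH].
  by rewrite (_ : n.+1%:Z = n%:Z + 1); [exact: Pp|lia].
by apply: Pm; rewrite (_ : - n.+1%:Z + 1 = - n%:Z)//; lia.
Qed.

(** The indefinite sum of g over the integers that vanishes at 0. *)
Definition psum (g : int -> int) (i : int) : int :=
  match i with
  | Posz n => \sum_(k < n) g k%:Z
  | Negz n => - \sum_(k < n.+1) g (- k.+1%:Z)
  end.

Lemma psum0 g : psum g 0 = 0. Proof. by rewrite /= big_ord0. Qed.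

Lemma psumS g i : psum g (i + 1) = psum g i + g i.
Proof.
case: i => n.
  by rewrite (_ : Posz n + 1 = Posz n.+1) /= ?big_ord_recr//; lia.
case: n => [|n].
  by rewrite (_ : Negz 0 + 1 = 0) /= ?big_ord0 ?big_ord1 ?NegzE ?addNr//; lia.
rewrite (_ : Negz n.+1 + 1 = Negz n) /=; last by lia.
by rewrite [in RHS]big_ord_recr/= NegzE opprD subrK.
Qed.

Lemma psum_unique g h : h 0 = 0 -> (forall i, h (i + 1) = h i + g i) -> psum g =1 h.
Proof.
move=> h0 hS; apply: int_step_ind => [|i|i]; first by rewrite psum0 h0.
  by rewrite psumS hS => ->.
by rewrite psumS hS => /addIr.
Qed.

Lemma psum_local g g' (i : int) :
  (forall k, (0 <= k) && (k < i) || (i <= k) && (k < 0) -> g k = g' k) ->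
  psum g i = psum g' i.
Proof.
case: i => n H /=; first by apply: eq_bigr => k _; apply: H; have := ltn_ord k; lia.
by congr (- _); apply: eq_bigr => k _; apply: H; have := ltn_ord k; lia.
Qed.

Section Image.
Variable f : cantor_space -> cantor_space.

Definition step (x : int -> 'I_3) (i : int) : int :=
  1 + if marked x i then gain f x i else 0.

(** The new position of i when every word is replaced by its image and 0 stays
    in place. The whole gain of a word is charged to the marker before it, so
    that pos is a translation on the rest of the word; it need not be monotone
    just after a marker. *)
Definition pos (x : int -> 'I_3) : int -> int := psum (step x).

Lemma pos0 x : pos x 0 = 0. Proof. exact: psum0. Qed.

Lemma posS x i : pos x (i + 1) = pos x i + step x i.
Proof. exact: psumS. Qed.

Lemma gain_shift n (x : int -> 'I_3) m : gain f (shiftz n (x : full_shift _)) m = gain f x (m + n).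
Proof.
have wE : word (shiftz n (x : full_shift _)) m = word x (m + n).
  by apply/funext => i; apply: word_ext => k _; rewrite /shiftz; congr x; lia.
rewrite /gain wE.
suff -> : `[< later_marker (shiftz n (x : full_shift _)) m >] =
  `[< later_marker x (m + n) >] by [].
apply: asbool_equiv_eq; split => -[k mk1 xk].
  by exists (k + n); [lia|exact: xk].
by exists (k - n); [lia|rewrite /marked /shiftz subrK].
Qed.

(** The cocycle rule, by which the construction descends to the mapping torus. *)
Lemma pos_shift n (x : int -> 'I_3) i :
  pos (shiftz n (x : full_shift _)) i = pos x (i + n) - pos x n.
Proof.
apply: (@psum_unique _ (fun i => pos x (i + n) - pos x n)); first by rewrite add0r subrr.
move=> k; have -> : step (shiftz n (x : full_shift _)) k = step x (k + n).
  by rewrite /step gain_shift.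
by rewrite (addrAC k) posS addrAC.
Qed.

Lemma pos_unmarked x (i j : int) : i <= j -> (forall k, i <= k -> k < j -> ~~ marked x k) ->
  pos x j = pos x i + (j - i).
Proof.
move=> ij; have [d ->] : exists d : nat, j = i + d%:Z by exists (absz (j - i)%R); lia.
elim: d {j ij} => [|d IH] nx; first by rewrite addr0 subrr addr0.
rewrite (_ : i + d.+1%:Z = i + d%:Z + 1); last by lia.
rewrite posS IH => [|k ik kd]; last by apply: nx; lia.
by rewrite /step ifN; [lia|apply: nx; lia].
Qed.

Lemma pos_word x (m i : int) : marked x m -> m < i -> (forall k, m < k -> k < i -> ~~ marked x k) ->
  pos x i = pos x m + gain f x m + (i - m).
Proof.
move=> xm mi nx; rewrite (@pos_unmarked x (m + 1) i) ?posS /step ?xm /=; first by lia.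
  by lia.
by move=> k mk1; apply: nx; lia.
Qed.

Section Admissible.
Variable x : int -> 'I_3.
Hypothesis ax : admissible x.

(** The gain turns the old distance of two consecutive markers into the new
    one. Since a word has length at least 0, markers keep their order. *)
Lemma pos_next (m m' : int) : m < m' -> marked x m -> marked x m' ->
  (forall k, m < k -> k < m' -> ~~ marked x k) ->
  pos x m' = pos x m + 1 + (word_size (f (word x m)))%:Z.
Proof.
move=> mm' xm xm' nx; rewrite (pos_word xm mm' nx) /gain asboolT; last by exists m'.
by have := word_size_gap ax mm' xm' nx; lia.
Qed.

Lemma pos_lt (m m' : int) : m < m' -> marked x m -> marked x m' -> pos x m < pos x m'.
Proof.
move=> mm' xm xm'; have [d] := ubnP (absz (m' - m)%R).
elim: d m mm' xm => // d IH m mm' xm lt.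
have [m2 [mm2 m2m' xm2 nx]] := next_marker mm' xm'.
have := pos_next mm2 xm xm2 nx.
case: (eqVneq m2 m') => [->|ne]; first by lia.
by have := IH m2 _ xm2 _; lia.
Qed.

Lemma pos_le (m m' : int) : m <= m' -> marked x m -> marked x m' -> pos x m <= pos x m'.
Proof. by rewrite le_eqVlt => /orP[/eqP ->//|*]; rewrite ltW// pos_lt. Qed.

Lemma pos_unmarked_lt (i m : int) : i < m -> marked x m -> ~~ marked x i ->  pos x i < pos x m.
Proof.
move=> im xm xi; have [m2 [im2 m2m xm2 nx]] := next_marker im xm.
have := pos_le m2m xm2 xm; rewrite (@pos_unmarked x i m2) => [|//|k]; [lia|lia|].
by rewrite le_eqVlt => /orP[/eqP <-//|]; exact: nx.
Qed.

End Admissible.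

(** The letter that lands on position j. It is a relation because the marker
    governing j has to be searched for; the letters to the left of all markers
    are carried along unchanged. *)
Inductive recoded (x : int -> 'I_3) (j : int) : 'I_3 -> Prop :=
| RecodedMarker m of marked x m & pos x m = j : recoded x j ord_max
| RecodedWord m (i : nat) of marked x m & j = pos x m + 1 + i%:Z &
    (forall m', m < m' -> marked x m' -> j < pos x m') : recoded x j (bit (f (word x m) i))
| RecodedLeft i of (forall m, m <= i -> ~~ marked x m) & pos x i = j : recoded x j (x i).

Lemma recoded_fun x j a b : admissible x -> recoded x j a -> recoded x j b -> a = b.
Proof.
move=> ax.
have left_lt i m : (forall m, m <= i -> ~~ marked x m) -> marked x m -> pos x i < pos x m.
  move=> nx xm; apply: pos_unmarked_lt => //; last exact: nx.
  by rewrite ltNge; apply/negP => /nx; rewrite xm.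
have mw m m' (i : nat) : marked x m -> pos x m = j -> marked x m' -> j = pos x m' + 1 + i%:Z ->
    (forall m2, m' < m2 -> marked x m2 -> j < pos x m2) -> False.
  move=> xm pm xm' jE nx; case: (ltP m' m) => [/nx/(_ xm)|le]; first by lia.
  by have := pos_le ax le xm xm'; lia.
case=> [m xm pm|m i xm jE nx|i nx pi]; case=> [m' xm' pm'|m' i' xm' jE' nx'|i' nx' pi'] //.
- by case: (mw m m' i').
- by have := left_lt _ _ nx' xm; lia.
- by case: (mw m' m i).
- case: (ltgtP m m') => [/nx/(_ xm')|/nx'/(_ xm)|]; [lia|lia|move=> mm'].
  by rewrite -mm' in jE' *; rewrite (_ : i = i')//; lia.
- by have := left_lt _ _ nx' xm; lia.
- by have := left_lt _ _ nx xm'; lia.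
- by have := left_lt _ _ nx xm'; lia.
- case: (leP i i') => ii'.
    have : pos x i' = pos x i + (i' - i).
      by apply: pos_unmarked => // k _ /ltW; exact: nx'.
    by rewrite pi pi' => H; rewrite (_ : i = i')//; lia.
  have : pos x i = pos x i' + (i - i').
    by apply: pos_unmarked => [|k _ /ltW]; [exact: ltW|exact: nx].
  by rewrite pi pi' => H; rewrite (_ : i = i')//; lia.
Qed.

(** Since pos strictly increases along the markers, stepping from marker to
    marker reaches the last one that lands at or before j, or else the first
    marker of all, after finitely many steps. *)
Lemma recoded_total x j : admissible x -> exists a, recoded x j a.
Proof.
move=> ax; case: (pselect (exists2 m, marked x m & pos x m <= j)) => [[m xm pm]|N].
  have [d] := ubnP (absz (j - pos x m)%R); elim: d m xm pm => // d IH m xm pm lt.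
  case: (pselect (exists m', [/\ m < m', marked x m' & pos x m' <= j])) => [[m' [mm' xm' pm']]|N].
    by apply: (IH m') => //; have := pos_lt ax mm' xm xm'; lia.
  case: (eqVneq (pos x m) j) => [pj|ne]; first by exists ord_max; exact: RecodedMarker xm pj.
  exists (bit (f (word x m) (absz (j - pos x m - 1)%R))); apply: RecodedWord => //; first by lia.
  by move=> m' mm' xm'; rewrite ltNge; apply/negP => le; apply: N; exists m'.
case: (pselect (exists m, marked x m)) => [[m xm]|N']; last first.
  have nx m : ~~ marked x m by apply/negP => xm; apply: N'; exists m.
  exists (x j); apply: RecodedLeft => //.
  by apply: (@psum_unique _ id) => // i; rewrite /step ifN// addr0.
have [d] := ubnP (absz (pos x m - j)%R); elim: d m xm => // d IH m xm lt.
have pj : j < pos x m by rewrite ltNge; apply/negP => le; apply: N; exists m.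
case: (pselect (exists2 m', m' < m & marked x m')) => [[m' mm' xm']|N''].
  apply: (IH m') => //; have := pos_lt ax mm' xm' xm.
  suff : j < pos x m' by lia.
  by rewrite ltNge; apply/negP => le; apply: N; exists m'.
have nx k : k < m -> ~~ marked x k by move=> km; apply/negP => xk; apply: N''; exists k.
exists (x (m - (pos x m - j))); apply: RecodedLeft => [k km|]; first by apply: nx; lia.
have : pos x m = pos x (m - (pos x m - j)) + (m - (m - (pos x m - j))).
  by apply: pos_unmarked => [|k _]; [lia|exact: nx].
lia.
Qed.

Definition recode (x : int -> 'I_3) : int -> 'I_3 :=
  fun j => xget ord_max [set a | recoded x j a].

Lemma recodeP x j : admissible x -> recoded x j (recode x j).
Proof. by move=> ax; rewrite /recode; case: xgetP => // N; have [a /N] := recoded_total j ax. Qed.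

Lemma recodeE x j a : admissible x -> recoded x j a -> recode x j = a.
Proof. by move=> ax; apply: recoded_fun => //; exact: recodeP. Qed.

End Image.

(** * The image sequence *)

Section ImageFacts.
Variables (f : cantor_space -> cantor_space).
Hypothesis Hf : prefix_exchange f.
Variable x : int -> 'I_3.
Hypothesis ax : admissible x.

Lemma marked_recode m : marked x m -> marked (recode f x) (pos f x m).
Proof. by move=> xm; apply/eqP/recodeE => //; exact: RecodedMarker xm erefl. Qed.

Lemma recode_letter m (i : nat) : marked x m ->
  (forall m', m < m' -> marked x m' -> pos f x m + 1 + i%:Z < pos f x m') ->
  recode f x (pos f x m + 1 + i%:Z) = bit (f (word x m) i).
Proof. by move=> xm nx; apply: recodeE => //; exact: RecodedWord. Qed.

Lemma recode_left i : (forall m, m <= i -> ~~ marked x m) -> recode f x (pos f x i) = x i.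
Proof. by move=> nx; apply: recodeE => //; exact: RecodedLeft. Qed.

Lemma marked_recodeP j : marked (recode f x) j -> exists2 m, marked x m & pos f x m = j.
Proof.
rewrite /marked; case: (recodeP f j ax) => [m xm pm _|m i _ _ _|i nx pi]; first by exists m.
  by rewrite bit_neq_max.
by move=> xi; have := nx _ (lexx i); rewrite /marked xi.
Qed.

Lemma pos_reflect_lt m m' : marked x m -> marked x m' -> pos f x m < pos f x m' -> m < m'.
Proof. by move=> xm xm'; rewrite !ltNge; apply: contra => /pos_le; exact. Qed.

Lemma later_marker_recode m : marked x m ->
  later_marker (recode f x) (pos f x m) <-> later_marker x m.
Proof.
move=> xm; split => [[k mk1 /marked_recodeP [m' xm' pm']]|[m' mm' xm']].
  by exists m' => //; apply: pos_reflect_lt => //; rewrite pm'.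
by exists (pos f x m'); [exact: pos_lt|exact: marked_recode].
Qed.

Lemma pos_next_ge m m' : m < m' -> marked x m -> marked x m' ->
  (forall k, m < k -> k < m' -> ~~ marked x k) ->
  forall k, m < k -> marked x k -> pos f x m' <= pos f x k.
Proof.
move=> mm' xm xm' nx k mk1 xk; apply: pos_le => //.
by rewrite leNgt; apply/negP => km'; have := nx _ mk1 km'; rewrite xk.
Qed.

(** The length of the image word was defined by dropping trailing zeros, so
    reading it back up to the next marker and padding gives the image word. *)
Lemma word_recode m : marked x m -> word (recode f x) (pos f x m) = f (word x m).
Proof.
move=> xm; case: (pselect (later_marker x m)) => [[k mk1 xk]|N]; last first.
  by apply: wordE => i; apply: recode_letter => // m' mm' xm'; case: N; exists m'.
have [m2 [mm2 _ xm2 nx]] := next_marker mk1 xk.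
have pE := pos_next f ax mm2 xm xm2 nx.
apply: (@wordE_fin _ _ _ (word_size (f (word x m)))).
- move=> i il; apply: recode_letter => // m' mm' xm'.
  by have := pos_next_ge mm2 xm xm2 nx mm' xm'; lia.
- by rewrite -pE; exact: marked_recode.
- have [n [G HG]] := prefix_ruleP Hf.
  by case: (word_sizeP (prefix_rule_vanish HG (word_vanish mm2 xm2))).
Qed.

(** A nonempty image word ends in 1, because its length is minimal; the letter
    before the very first marker is inherited from x. *)
Lemma admissible_recode : admissible (recode f x).
Proof.
move=> j yj; apply/negP => /marked_recodeP [m xm pm].
case: (pselect (exists2 m', m' < m & marked x m')) => [[m' mm' xm']|N].
  have [m1 [m'm1 m1m xm1 nx]] := @prev_marker x m' (m - 1) ltac:(lia) xm'.
  have m1m' : m1 < m by lia.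
  have nx' k : m1 < k -> k < m -> ~~ marked x k by move=> ? ?; apply: nx; lia.
  have pE := pos_next f ax m1m' xm1 xm nx'.
  have [n [G HG]] := prefix_ruleP Hf.
  have [_] := word_sizeP (prefix_rule_vanish HG (word_vanish m1m' xm)).
  case lE : (word_size _) pE => [|l] pE.
    have := marked_recode xm1; rewrite (_ : pos f x m1 = j); last by lia.
    by rewrite /marked yj bit_neq_max.
  move=> /(_ _ erefl) fl; move: yj.
  rewrite (_ : j = pos f x m1 + 1 + l%:Z); last by lia.
  rewrite recode_letter// ?fl => [/bit_inj//|m2 m1m2 xm2].
  by have := pos_next_ge m1m' xm1 xm nx' m1m2 xm2; lia.
have nx k : k < m -> ~~ marked x k by move=> km; apply/negP => xk; apply: N; exists k.
have pE : pos f x m = pos f x (m - 1) + (m - (m - 1)).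
  by apply: pos_unmarked => [|k _]; [lia|exact: nx].
move: yj; rewrite (_ : j = pos f x (m - 1)); last by lia.
rewrite recode_left => [|k km]; last by apply: nx; lia.
by move=> /ax; rewrite subrK xm.
Qed.

(** Moving the origin moves the image along its orbit, by the amount that
    pos_shift accounts for. *)
Lemma recode_shift n j :
  recode f (shiftz n (x : full_shift _)) j = recode f x (j + pos f x n).
Proof.
have axn : admissible (shiftz n (x : full_shift _)).
  by move=> i /ax; rewrite /marked /shiftz addrAC.
apply: recodeE => //; move e : (j + pos f x n) => j'.
have wE m : word x m = word (shiftz n (x : full_shift _)) (m - n).
  by apply/funext => i; apply: word_ext => k _; rewrite /shiftz; congr x; lia.
case: (recodeP f j' ax) => [m xm pm|m i xm j'E nx|i nx pi].
- apply: (@RecodedMarker _ _ _ (m - n)); first by rewrite /marked /shiftz subrK.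
  by rewrite pos_shift subrK; lia.
- rewrite wE; apply: RecodedWord; first by rewrite /marked /shiftz subrK.
    by rewrite pos_shift subrK; lia.
  move=> m' mm' xm'; rewrite pos_shift.
  by have := nx (m' + n) ltac:(lia) xm'; lia.
- rewrite (_ : x i = shiftz n (x : full_shift _) (i - n)); last by rewrite /shiftz subrK.
  apply: RecodedLeft => [m mi|]; first by apply: nx; lia.
  by rewrite pos_shift subrK; lia.
Qed.

End ImageFacts.

Section Composition.
Variables (g f : cantor_space -> cantor_space).
Hypothesis Hg : prefix_exchange g.
Hypothesis Hf : prefix_exchange f.
Variable x : int -> 'I_3.
Hypothesis ax : admissible x.

Lemma gain_comp m : marked x m ->
  gain (g \o f) x m = gain f x m + gain g (recode f x) (pos f x m).
Proof.
move=> xm; rewrite /gain word_recode// (asbool_equiv_eq (later_marker_recode f ax xm)).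
by case: ifP => _ /=; [lia|exact: germ_comp].
Qed.

Lemma pos_comp_diff m m' : m < m' -> marked x m -> marked x m' ->
  pos g (recode f x) (pos f x m') - pos g (recode f x) (pos f x m) =
  pos (g \o f) x m' - pos (g \o f) x m.
Proof.
have ay := admissible_recode Hf ax.
move=> mm' xm xm'; have [d] := ubnP (absz (m' - m)%R).
elim: d m mm' xm => // d IH m mm' xm lt.
have [m2 [mm2 m2m' xm2 nx]] := next_marker mm' xm'.
have h1 := pos_next (g \o f) ax mm2 xm xm2 nx.
have h2 : pos g (recode f x) (pos f x m2) = pos g (recode f x) (pos f x m) + 1 +
    (word_size (g (word (recode f x) (pos f x m))))%:Z.
  apply: pos_next => //; [exact: pos_lt|exact: marked_recode|exact: marked_recode|].
  move=> k mk1 km; apply/negP => /(marked_recodeP ax) [l xl pl].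
  rewrite -pl in mk1 km; have := nx l (pos_reflect_lt ax xm xl mk1) (pos_reflect_lt ax xl xm2 km).
  by rewrite xl.
rewrite word_recode// in h2.
case: (eqVneq m2 m') => [<-|ne]; first by rewrite h1 h2/=; lia.
by have := IH m2 ltac:(lia) xm2 ltac:(lia); rewrite h1 h2/=; lia.
Qed.

Hypothesis x0 : marked x 0.

(** The origin must be a marker here: otherwise the marker before 0 may land
    after 0, and the two sides, which both fix 0, differ by a translation. *)
Lemma pos_comp m : marked x m -> pos g (recode f x) (pos f x m) = pos (g \o f) x m.
Proof.
move=> xm; case: (ltgtP m 0) => [m0|m0|->]; last by rewrite !pos0.
  by have := pos_comp_diff m0 xm x0; rewrite !pos0; lia.
by have := pos_comp_diff m0 x0 xm; rewrite !pos0; lia.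
Qed.

Lemma unmarked_recode i : (forall m, m <= i -> ~~ marked x m) ->
  forall m, m <= pos f x i -> ~~ marked (recode f x) m.
Proof.
move=> nx m mi; apply/negP => /(marked_recodeP ax) [k xk pk].
have ik : i < k by rewrite ltNge; apply/negP => /nx; rewrite xk.
by have := pos_unmarked_lt f ax ik xk (nx _ (lexx _)); lia.
Qed.

Lemma pos_comp_left i : (forall m, m <= i -> ~~ marked x m) ->
  pos g (recode f x) (pos f x i) = pos (g \o f) x i.
Proof.
move=> nx; have i0 : i < 0 by rewrite ltNge; apply/negP => /nx; rewrite x0.
have [m [im m0 xm nm]] := next_marker i0 x0.
have nm' k : i <= k -> k < m -> ~~ marked x k.
  by rewrite le_eqVlt => /orP[/eqP <- _|]; [exact: nx|exact: nm].
have e1 := @pos_unmarked f x i m (ltW im) nm'.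
have e2 := @pos_unmarked (g \o f) x i m (ltW im) nm'.
have e3 : pos g (recode f x) (pos f x m) = pos g (recode f x) (pos f x i) + (pos f x m - pos f x i).
  apply: pos_unmarked => [|k ik km]; first by lia.
  apply/negP => /(marked_recodeP ax) [l xl pl].
  have lm : l < m by apply: (@pos_reflect_lt f _ ax _ _ xl xm); rewrite pl.
  have li : i < l by rewrite ltNge; apply/negP => /nx; rewrite xl.
  by have := nm _ li lm; rewrite xl.
by have := pos_comp xm; lia.
Qed.

Lemma recode_comp : recode g (recode f x) = recode (g \o f) x.
Proof.
have ay := admissible_recode Hf ax.
apply/funext => j; apply: recodeE => //.
case: (recodeP (g \o f) j ax) => [m xm <-|m i xm jE nx|i nx pi].
- by rewrite -pos_comp//; apply: RecodedMarker; first exact: (marked_recode f ax xm).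
- rewrite /= -word_recode//; apply: RecodedWord; first exact: marked_recode.
    by rewrite pos_comp.
  move=> m' mm' /(marked_recodeP ax) [k xk pk]; rewrite -pk pos_comp//.
  by apply: nx => //; apply: (@pos_reflect_lt f _ ax _ _ xm xk); rewrite pk.
- rewrite -(recode_left f ax nx); apply: RecodedLeft; first exact: unmarked_recode.
  by rewrite pos_comp_left.
Qed.

End Composition.

Lemma gain_id x m : gain id x m = 0.
Proof.
rewrite /gain subrr; case: ifP => // _.
by rewrite (@germE _ _ 0 0)// => z _; split.
Qed.

Lemma pos_id x i : pos id x i = i.
Proof. by apply: (@psum_unique _ id) => // k; rewrite /step gain_id if_same addr0. Qed.

Lemma recode_id x : admissible x -> recode id x = x.
Proof.
move=> ax; apply/funext => j; case: (recodeP id j ax) => [m|m i xm + nx|i _]; rewrite pos_id.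
- by move=> /eqP xm <-; rewrite xm.
- move=> jE; rewrite jE -word_letter => // k mk1 kj; apply/negP => xk.
  by have := nx _ mk1 xk; rewrite pos_id jE; lia.
- by move=> ->.
Qed.

Lemma pos_unmarked_id f x : (forall m, ~~ marked x m) -> forall i, pos f x i = i.
Proof. by move=> nx i; apply: (@psum_unique _ id) => // k; rewrite /step ifN ?addr0. Qed.

Lemma recode_unmarked f x : admissible x -> (forall m, ~~ marked x m) -> recode f x = x.
Proof.
move=> ax nx; apply/funext => j.
by rewrite -{1}(pos_unmarked_id f nx j) recode_left.
Qed.

(** * Locality *)

Definition agree_upto (N : int) (x x' : int -> 'I_3) :=
  forall k, - N <= k -> k <= N -> x k = x' k.

Section Local.
Variables (f : cantor_space -> cantor_space) (n : nat) (G : cantor_space -> seq bool).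
Hypothesis Hf : prefix_rule f n G.
Variable x : int -> 'I_3.
Hypothesis ax : admissible x.

Lemma pos_local x' (N i : int) : admissible x' -> agree_upto N x x' ->
  - N <= i -> i + n%:Z + 2 <= N -> n%:Z + 2 <= N -> pos f x i = pos f x' i.
Proof.
move=> ax' xx' Ni iN nN; apply: psum_local => k ki.
have xk : x k = x' k by apply: xx'; lia.
rewrite /step (gain_local Hf ax ax') => [|l kl ln]; last by apply: xx'; lia.
by rewrite /marked xk.
Qed.

(** Beyond the prefix that f exchanges, a word is only translated. *)
Lemma recode_tail i : (forall k, i - n%:Z - 1 <= k -> k <= i -> ~~ marked x k) ->
  recode f x (pos f x i) = x i.
Proof.
move=> nx; case: (pselect (exists2 m, m <= i & marked x m)) => [[m0 m0i xm0]|N]; last first.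
  by apply: recode_left => // m mi; apply/negP => xm; apply: N; exists m.
have [m [_ mi xm nm]] := prev_marker m0i xm0.
have mi' : m < i - n%:Z - 1.
  by rewrite ltNge; apply/negP => le; have := nx _ le mi; rewrite xm.
have pE : pos f x i = pos f x m + gain f x m + (i - m).
  by apply: pos_word => [||k mk1 ki]; [|lia|apply: nm; lia].
have cE : gain f x m = (size (G (word x m)))%:Z - n%:Z.
  by apply: (gain_long Hf) => // k mk1 kn; apply: nm; lia.
(* the index of i in its word, counted from the end of the exchanged prefix *)
pose d := (absz (i - m - 1)%R - n)%N.
rewrite (_ : pos f x i = pos f x m + 1 + (size (G (word x m)) + d)%N%:Z); last by rewrite /d; lia.
rewrite recode_letter//; last first.
  move=> m' mm' xm'; have im' : i < m'.
    by rewrite ltNge; apply/negP => le; have := nm _ mm' le; rewrite xm'.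
  have := pos_unmarked_lt f ax im' xm' (nx i ltac:(lia) (lexx i)).
  by rewrite /d; lia.
rewrite (prefix_rule_tail Hf) -word_letter => [|k mk1 ki]; last first.
  by apply: nm => //; rewrite /d in ki; lia.
by congr x; rewrite /d; lia.
Qed.

End Local.

(** This is the continuity of the recoding. Sequences that agree with x on a
    window may have further markers outside it: those to the right land far
    to the right by gain_ge, and those to the left only translate the letters
    inside the window by recode_tail. *)
Lemma recode_local f x j : prefix_exchange f -> admissible x ->
  exists N, forall x', admissible x' -> agree_upto N x x' -> recode f x' j = recode f x j.
Proof.
move=> /prefix_ruleP [n [G Hf]] ax.
case: (recodeP f j ax) => [m xm pm|m i xm jE nx|i nx pi].
- exists (`|m| + n%:Z + 3) => x' ax' xx'.
  have pE : pos f x m = pos f x' m by apply: (pos_local Hf ax ax' xx'); lia.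
  rewrite -pm pE; apply/eqP; apply: marked_recode => //.
  by rewrite /marked -xx'//; lia.
- have key x' : admissible x' -> agree_upto (`|m| + n%:Z + i%:Z + 3) x x' ->
      [/\ marked x' m, j = pos f x' m + 1 + i%:Z & f (word x' m) i = f (word x m) i].
    move=> ax' xx'; split; first by rewrite /marked -xx'//; lia.
      by rewrite -(@pos_local f n G Hf x ax x' _ m ax' xx') //; lia.
    apply: esym; apply: (@prefix_rule_agree f n G Hf _ _ i.+1); last by lia.
    by move=> k ki; apply: word_ext => l lk; apply: xx'; lia.
  case: (pselect (later_marker x m)) => [[k mk1 xk]|N].
    have [m2 [mm2 _ xm2 nm]] := next_marker mk1 xk.
    exists (`|m| + n%:Z + i%:Z + `|m2| + 3) => x' ax' xx'.
    have [|xmm jE' <-] := key x' ax'; first by move=> l ? ?; apply: xx'; lia.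
    rewrite jE'; apply: recode_letter => // m' mm' xm'; rewrite -jE'.
    have p2 : pos f x m2 = pos f x' m2 by apply: (pos_local Hf ax ax' xx'); lia.
    have xm2' : marked x' m2 by rewrite /marked -xx'//; lia.
    have := nx _ mm2 xm2; rewrite p2 => /lt_le_trans; apply.
    apply: pos_le => //; rewrite leNgt; apply/negP => m'm2.
    by move: xm'; rewrite /marked -xx'; [exact/negP/nm|lia|lia].
  (* the terms in j and pos make any marker outside the window land after j *)
  exists (`|m| + n%:Z + i%:Z + `|j| + `|pos f x m| + 3) => x' ax' xx'.
  have [|xmm jE' <-] := key x' ax'; first by move=> l ? ?; apply: xx'; lia.
  rewrite jE'; apply: recode_letter => // m' mm' xm'; rewrite -jE'.
  have [m2 [mm2 m2m' xm2 nm]] := next_marker mm' xm'.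
  have m2N : `|m| + n%:Z + i%:Z + `|j| + `|pos f x m| + 3 < m2.
    rewrite ltNge; apply/negP => le; apply: N; exists m2 => //.
    by rewrite /marked xx'//; lia.
  have := pos_word f xmm mm2 nm; have := gain_ge Hf m ax'.
  have := pos_le f ax' m2m' xm2 xm'.
  by rewrite -(@pos_local f n G Hf x ax x' _ m ax' xx'); lia.
- exists (`|i| + n%:Z + 3) => x' ax' xx'.
  have pE : pos f x i = pos f x' i by apply: (pos_local Hf ax ax' xx'); lia.
  rewrite -pi pE (recode_tail Hf ax'); first by rewrite xx'//; lia.
  by move=> k ik ki; rewrite /marked -xx'; [exact: nx|lia|lia].
Qed.

(** * Reparametrisation of the flow lines *)

Section Dilation.
Variable R : realType.
Implicit Types (t s : R) (c d : int).

(** A homeomorphism of the half line that fixes 0 and is the translation by 1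
    on [1, +oo). Its iterates are an action of the integers, and the iterate
    of order c maps [0, L] onto [0, L + c] whenever L and L + c are at least 1;
    these two properties fit segments of flow lines together and make the
    composition of the resulting maps exact. *)
Definition dil t : R := Num.min (2 * t) (t + 1).
Definition con t : R := Num.max (t / 2) (t - 1).

Lemma dilK : cancel dil con.
Proof.
by move=> t; rewrite /dil /con minElt maxElt; case: (ltP (2 * t)) => ?; case: ltP => ?; lra.
Qed.

Lemma conK : cancel con dil.
Proof.
by move=> t; rewrite /dil /con minElt maxElt; case: (ltP (t / 2)) => ?; case: ltP => ?; lra.
Qed.

Lemma dil_lt : {homo dil : t s / t < s}.
Proof.
by move=> t s ts; rewrite /dil !minElt; case: (ltP (2 * t)) => ?; case: (ltP (2 * s)) => ?; lra.
Qed.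

Lemma con_lt : {homo con : t s / t < s}.
Proof.
by move=> t s ts; rewrite /con !maxElt; case: (ltP (t / 2)) => ?; case: (ltP (s / 2)) => ?; lra.
Qed.

Definition dilate c t : R :=
  match c with Posz n => iter n dil t | Negz n => iter n.+1 con t end.

Lemma dilateS c t : dilate (c + 1) t = dil (dilate c t).
Proof.
case: c => [n|[|n]]; first by rewrite (_ : Posz n + 1 = n.+1) //; lia.
  by rewrite /= conK.
by rewrite (_ : Negz n.+1 + 1 = Negz n) /= ?conK//; lia.
Qed.

Lemma dilateD c d t : dilate (c + d) t = dilate c (dilate d t).
Proof.
move: c; apply: int_step_ind => [|c|c]; first by rewrite add0r.
  by rewrite addrAC !dilateS => ->.
by rewrite addrAC !dilateS => /(can_inj dilK).
Qed.

Lemma dilate_lt c : {homo dilate c : t s / t < s}.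
Proof.
move=> t s ts; case: c => n /=; first by elim: n => //= n; exact: dil_lt.
by apply: con_lt; elim: n => //= n; exact: con_lt.
Qed.

Lemma dilate0 c : dilate c 0 = 0.
Proof.
have d0 : dil 0 = 0 by rewrite /dil minElt; case: ltP => ?; lra.
move: c; apply: int_step_ind => [//|c|c]; rewrite dilateS; first by move=> ->.
by rewrite -[in RHS]d0 => h; apply: (can_inj dilK); rewrite h d0.
Qed.

Lemma dilate_far c t : 1 <= t -> 1 <= t + c%:~R -> dilate c t = t + c%:~R.
Proof.
move=> t1; case: c => n; elim: n => [|n IH].
- by rewrite addr0.
- rewrite (_ : Posz n.+1 = Posz n + 1); last by lia.
  rewrite dilateS intrD => _; have n0 : 0 <= (Posz n)%:~R :> R by rewrite ler0z.
  rewrite IH; last by lra.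
  by rewrite /dil minElt; case: ltP => ?; lra.
- by rewrite NegzE /= /con maxElt; case: ltP => ?; lra.
- rewrite (_ : Negz n.+1 = Negz n - 1); last by lia.
  move=> tn; apply: (can_inj dilK); rewrite -dilateS subrK.
  move: tn; rewrite intrB => tn; rewrite IH; last by lra.
  by rewrite /dil minElt; case: ltP => ?; lra.
Qed.

End Dilation.

Section TimeMap.
Variable R : realType.
Implicit Types (t s : R) (x : int -> 'I_3).

Lemma int_lt1 (m m' : int) : m < m' -> m%:~R + 1 <= m'%:~R :> R.
Proof. by move=> mm'; rewrite -(intrD _ _ 1) ler_int; lia. Qed.

Section SingleMap.
Variable f : cantor_space -> cantor_space.

(** The new time of the point at time t. The segment of the flow line that
    starts at a marker goes to the segment of its image by dilate; left of all
    markers the flow line is translated, by an amount that does not depend on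
    the choice of i. *)
Inductive retimed x t : R -> Prop :=
| RetimedWord m of marked x m & m%:~R <= t & (forall m', m < m' -> marked x m' -> t < m'%:~R) :
    retimed x t ((pos f x m)%:~R + dilate (gain f x m) (t - m%:~R))
| RetimedLeft i of (forall m, m <= i -> ~~ marked x m) & (forall m, marked x m -> t < m%:~R) :
    retimed x t (t - i%:~R + (pos f x i)%:~R).

Definition retime x t : R := xget 0 [set s | retimed x t s].

Lemma retimed_fun x t s s' : retimed x t s -> retimed x t s' -> s = s'.
Proof.
case=> [m xm mt nx|i nx nt]; case=> [m' xm' mt' nx'|i' nx' nt'].
- case: (ltgtP m m') => [/nx/(_ xm')|/nx'/(_ xm)|-> //]; lra.
- by have := nt' _ xm; lra.
- by have := nt _ xm'; lra.
- wlog ii' : i i' nx nx' / i <= i'.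
    by move=> H; case: (leP i i') => [|/ltW] h; [|apply: esym]; exact: H.
  have -> : pos f x i' = pos f x i + (i' - i).
    by apply: pos_unmarked => // k _ /ltW; exact: nx'.
  by rewrite intrD intrB; lra.
Qed.

Lemma retimed_total x t : exists s, retimed x t s.
Proof.
have /andP[f1 f2] := floor_itv t; set i := Num.floor t in f1 f2.
have int_le (m : int) : m%:~R <= t -> m <= i.
  by move=> mt; have : m%:~R < (i + 1)%:~R :> R by [lra]; rewrite ltr_int; lia.
case: (pselect (exists2 m, m <= i & marked x m)) => [[m0 m0i xm0]|N].
  have [m [_ mi xm nx]] := prev_marker m0i xm0.
  eexists; apply: (@RetimedWord _ _ m) => //.
    by apply: le_trans f1; rewrite ler_int.
  move=> m' mm' xm'; rewrite ltNge; apply/negP => /int_le m'i.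
  by have := nx _ mm' m'i; rewrite xm'.
eexists; apply: (@RetimedLeft _ _ i) => m xm; first by apply/negP => ?; apply: N; exists m.
by rewrite ltNge; apply/negP => /int_le mi; apply: N; exists m.
Qed.

Lemma retimeP x t : retimed x t (retime x t).
Proof. by rewrite /retime; case: xgetP => // N; have [a /N] := retimed_total x t. Qed.

Lemma retimeE x t s : retimed x t s -> retime x t = s.
Proof. by apply: retimed_fun; exact: retimeP. Qed.

Lemma retime_shift n x t :
  retime (shiftz n (x : full_shift _)) (t - n%:~R) = retime x t - (pos f x n)%:~R.
Proof.
apply: retimeE; case: (retimeP x t) => [m xm mt nx|i nx nt].
- rewrite [X in retimed _ _ X](_ : _ = (pos f (shiftz n (x : full_shift _)) (m - n))%:~R +
    dilate (gain f (shiftz n (x : full_shift _)) (m - n)) (t - n%:~R - (m - n)%:~R)).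
    apply: RetimedWord; first by rewrite /marked /shiftz subrK.
      by rewrite intrB; lra.
    by move=> m' mm' xm'; have := nx (m' + n) ltac:(lia) xm'; rewrite intrD; lra.
  rewrite pos_shift gain_shift subrK !intrB (_ : t - n%:~R - (m%:~R - n%:~R) = t - m%:~R); lra.
- rewrite [X in retimed _ _ X](_ : _ = t - n%:~R - (i - n)%:~R +
    (pos f (shiftz n (x : full_shift _)) (i - n))%:~R).
    apply: RetimedLeft => [m mi|m xm]; first by apply: nx; lia.
    by have := nt _ xm; rewrite intrD; lra.
  by rewrite pos_shift subrK !intrB; lra.
Qed.

Lemma retime_unmarked x t : (forall m, ~~ marked x m) -> retime x t = t.
Proof.
move=> nx; apply: retimeE; 
  rewrite -[X in retimed _ _ X]addr0 -[X in _ + X](_ : (0 : int)%:~R = 0)//.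
rewrite -(pos0 f x) -{2}[t]subr0 -{1}[X in _ - X](_ : (0 : int)%:~R = 0)//.
by apply: RetimedLeft => // m; rewrite (negbTE (nx m)).
Qed.

Section AdmissibleTime.
Variable x : int -> 'I_3.
Hypothesis ax : admissible x.

(** Consecutive markers are at distance at least 1, before and after recoding,
    where dilate is a translation. So the images of consecutive segments share
    an endpoint. *)
Lemma dilate_next (m m' : int) : m < m' -> marked x m -> marked x m' ->
  (forall k, m < k -> k < m' -> ~~ marked x k) ->
  (pos f x m)%:~R + dilate (gain f x m) (m'%:~R - m%:~R) = (pos f x m')%:~R :> R.
Proof.
move=> mm' xm xm' nx; have h := pos_next f ax mm' xm xm' nx.
have h' := pos_word f xm mm' nx.
have c1 : 1 <= m' - m + gain f x m by lia.
rewrite -intrB dilate_far -?intrD; [by congr (_%:~R); lia| |].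
  by rewrite (ler_int _ 1); lia.
by rewrite (ler_int _ 1).
Qed.

Lemma retime_word_bounds m t : marked x m -> m%:~R <= t ->
  (forall m', m < m' -> marked x m' -> t < m'%:~R) ->
  (pos f x m)%:~R <= retime x t /\
  forall m', m < m' -> marked x m' -> retime x t < (pos f x m')%:~R.
Proof.
move=> xm mt nx; rewrite (retimeE (RetimedWord xm mt nx)); split => [|m' mm' xm'].
  have : 0 <= dilate (gain f x m) (t - m%:~R); last by lra.
  move: mt; rewrite le_eqVlt => /orP[/eqP ->|mt]; first by rewrite subrr dilate0.
  by rewrite -[leLHS](dilate0 R (gain f x m)); apply/ltW/dilate_lt; lra.
have [m2 [mm2 m2m' xm2 nx2]] := next_marker mm' xm'.
apply: (@lt_le_trans _ _ (pos f x m2)%:~R); last by rewrite ler_int; exact: pos_le.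
by rewrite -(dilate_next mm2)// ltrD2l; apply: dilate_lt; have := nx _ mm2 xm2; lra.
Qed.

Lemma retime_left_bound i t : (forall m, m <= i -> ~~ marked x m) ->
  (forall m, marked x m -> t < m%:~R) -> forall m, marked x m -> retime x t < (pos f x m)%:~R.
Proof.
move=> nx nt m xm; rewrite (retimeE (RetimedLeft nx nt)).
have im : i < m by rewrite ltNge; apply/negP => /nx; rewrite xm.
have [m2 [im2 m2m xm2 nx2]] := next_marker im xm.
apply: (@lt_le_trans _ _ (pos f x m2)%:~R); last by rewrite ler_int; exact: pos_le.
rewrite (@pos_unmarked f x i m2 (ltW im2)) ?intrD ?intrB; first by have := nt _ xm2; lra.
by move=> k; rewrite le_eqVlt => /orP[/eqP <- _|]; [exact: nx|exact: nx2].
Qed.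

Lemma retime_lt : {homo retime x : t s / t < s}.
Proof.
move=> t s ts; case: (retimeP x s) => [m' xm' mt' nx'|i' nx' nt'].
- have [b1 b2] := retime_word_bounds xm' mt' nx'.
  have := retimeE (RetimedWord xm' mt' nx') => sE; rewrite -sE.
  case: (retimeP x t) => [m xm mt nx|i nx nt]; last first.
    rewrite -(retimeE (RetimedLeft nx nt)); apply: lt_le_trans b1.
    exact: retime_left_bound nx nt _ xm'.
  have [c1 c2] := retime_word_bounds xm mt nx.
  case: (ltgtP m m') => [mm'|mm'|mm'].
  + by rewrite -(retimeE (RetimedWord xm mt nx)); apply: lt_le_trans b1; exact: c2.
  + by have := nx' _ mm' xm; lra.
  + by rewrite sE mm' ltrD2l; apply: dilate_lt; lra.
- rewrite (@retimeE x t (t - i'%:~R + (pos f x i')%:~R)); first by lra.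
  by apply: RetimedLeft => // m /nt'; lra.
Qed.

End AdmissibleTime.

(** The last hypothesis says that the segment containing t starts inside the
    window, or that t is to the left of all markers of x. In the second case a
    marker of x' to the left of t is so far away that dilate acts at t as a
    translation, which pos accounts for. *)
Lemma retime_local n G x x' N t : prefix_rule f n G -> admissible x -> admissible x' ->
  agree_upto N x x' -> `|t| + n%:R + 3 <= N%:~R ->
  (exists M, [/\ - N <= M, M%:~R <= t & marked x M]) \/ (forall m, marked x m -> t < m%:~R) ->
  retime x t = retime x' t.
Proof.
move=> Hf ax ax' xx' tN anchor; apply: esym.
have nE : n%:R = (n%:Z)%:~R :> R by rewrite -pmulrn.
rewrite nE in tN.
have tb : - `|t| <= t /\ t <= `|t| by split; [rewrite lerNl -normrN ler_norm|rewrite ler_norm].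
have t0 : 0 <= `|t| by exact: normr_ge0.
have N3 : n%:Z + 3 <= N by rewrite -(ler_int R) intrD; lra.
have int_le (m : int) : m%:~R <= t -> m + n%:Z + 2 <= N.
  by move=> mt; rewrite -(ler_int R) !intrD; lra.
have int_ge (m : int) : t < (m + 1)%:~R -> - N <= m.
  by rewrite -(ler_int R) intrD mulrNz; have : 0 <= n%:Z%:~R :> R; [rewrite ler0z|lra].
have int_le' (m : int) : m%:~R <= t -> m <= N by move=> /int_le; lia.
case: (retimeP x t) => [m xm mt nx|i nx nt].
- case: anchor => [[M [NM Mt xM]]|/(_ _ xm)]; last by lra.
  have Mm : M <= m by rewrite leNgt; apply/negP => /nx/(_ xM); lra.
  have h := int_le _ mt.
  have -> : pos f x m = pos f x' m by apply: (pos_local Hf ax ax' xx'); lia.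
  have -> : gain f x m = gain f x' m by apply: (gain_local Hf ax ax') => k *; apply: xx'; lia.
  apply: retimeE; apply: RetimedWord => //; first by rewrite /marked -xx'//; lia.
  move=> m' mm' xm'; rewrite ltNge; apply/negP => mt'.
  have := nx m' mm'; rewrite /marked xx' => [/(_ xm')||]; [lra|lia|exact: int_le'].
rewrite -(retimeE (RetimedLeft nx nt)).
have /andP[f1 f2] := floor_itv t; set l := Num.floor t in f1 f2.
have nxl m : m <= l -> ~~ marked x m.
  move=> ml; apply/negP => /nt; apply/negP; rewrite -leNgt.
  by apply: le_trans f1; rewrite ler_int.
rewrite (retimeE (RetimedLeft nxl nt)).
have lN := int_le _ f1; have Nl := int_ge _ f2.
have -> : pos f x l = pos f x' l by apply: (pos_local Hf ax ax' xx'); lia.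
have above m : l < m -> t < m%:~R.
  by move=> lm; apply: lt_le_trans f2 _; rewrite ler_int; lia.
apply: retimeE.
case: (pselect (exists2 m, m <= l & marked x' m)) => [[m0 m0l xm0]|none]; last first.
  have nx' m : m <= l -> ~~ marked x' m by move=> ml; apply/negP => ?; apply: none; exists m.
  apply: RetimedLeft => // m xm; apply: above; rewrite ltNge; apply/negP => /nx'.
  by rewrite xm.
have [m [_ ml xm nm]] := prev_marker m0l xm0.
have mN : m < - N.
  rewrite ltNge; apply/negP => Nm; have := nxl _ ml.
  by rewrite /marked xx'//; [exact/negP/negPn|lia].
have pE := @pos_word f x' m l xm ltac:(lia) (fun k h1 h2 => nm k h1 (ltW h2)).
have cg := gain_ge Hf m ax'.
have mNR : m%:~R + 1 <= - N%:~R :> R by rewrite -mulrNz; exact: int_lt1.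
have cgR : - (n%:Z)%:~R <= (gain f x' m)%:~R :> R by rewrite -mulrNz ler_int.
have n0 : 0 <= n%:Z%:~R :> R by rewrite ler0z.
have -> : t - l%:~R + (pos f x' l)%:~R =
    (pos f x' m)%:~R + dilate (gain f x' m) (t - m%:~R).
  by rewrite dilate_far; [rewrite pE !intrD mulrNz; lra|lra|lra].
apply: RetimedWord => //; first by lra.
move=> m' mm' xm'; apply: above; rewrite ltNge; apply/negP => m'l.
by have := nm _ mm' m'l; rewrite xm'.
Qed.

End SingleMap.

(** Gains add up by gain_comp and dilate is an action, so the maps compose
    exactly and not only up to isotopy. *)
Lemma retime_comp g f x t : prefix_exchange g -> prefix_exchange f -> admissible x -> marked x 0 ->
  retime g (recode f x) (retime f x t) = retime (g \o f) x t.
Proof.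
move=> Hg Hf ax x0; have ay := admissible_recode Hf ax.
apply: retimeE; case: (retimeP (g \o f) x t) => [m xm mt nx|i nx nt].
- have [b1 b2] := retime_word_bounds f ax xm mt nx.
  have -> : (pos (g \o f) x m)%:~R + dilate (gain (g \o f) x m) (t - m%:~R) =
     (pos g (recode f x) (pos f x m))%:~R +
     dilate (gain g (recode f x) (pos f x m)) (retime f x t - (pos f x m)%:~R).
    have -> : retime f x t - (pos f x m)%:~R = dilate (gain f x m) (t - m%:~R).
      by rewrite (retimeE (RetimedWord f xm mt nx)) addrC addKr.
    by rewrite pos_comp// gain_comp// [gain f x m + _]addrC dilateD.
  apply: RetimedWord => //; first exact: marked_recode.
  move=> m' mm' /(marked_recodeP ax) [k xk pk]; rewrite -pk; apply: b2 => //.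
  by apply: (@pos_reflect_lt f _ ax _ _ xm xk); rewrite pk.
- have -> : t - i%:~R + (pos (g \o f) x i)%:~R =
     retime f x t - (pos f x i)%:~R + (pos g (recode f x) (pos f x i))%:~R.
    by rewrite pos_comp_left// (retimeE (RetimedLeft f nx nt)); lra.
  apply: RetimedLeft; first exact: unmarked_recode.
  move=> m /(marked_recodeP ax) [k xk <-]; exact: retime_left_bound nx nt _ xk.
Qed.

Lemma retime_id x t : retime id x t = t.
Proof.
by case: (retimeP id x t) => [m xm mt nx|i nx nt]; rewrite pos_id ?gain_id /=; lra.
Qed.

End TimeMap.

(** * Topology of the subshift *)

Lemma full_shift_cvg (T : topologicalType) (A : finType) (u : T -> full_shift A) (t : T) :
  (forall j, \forall s \near t, u s j = u t j) -> u @ t --> u t.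
Proof.
move=> H; apply/cvg_sup => j U [V [[W oW <-] Wf WU]].
by apply: filterS (H j) => s e; apply: WU; rewrite /= /proj e.
Qed.

Lemma near_letter (A : finType) (x : full_shift A) i : \forall y \near x, y i = x i.
Proof.
exact: (@proj_continuous int (fun _ => discrete_topology A) i x [set x i] (discrete_set1 _)).
Qed.

Lemma near_agree_upto (x : full_shift 'I_3) N : \forall y \near x, agree_upto N x y.
Proof.
have H (n : nat) : \forall y \near x, forall k : int, (absz k < n)%N -> x k = y k.
  elim: n => [|n IH]; first by near=> y.
  near=> y => k; rewrite ltnS leq_eqVlt => /orP[kn|]; last by move: k; near: y.
  have [->|->] : k = n%:Z \/ k = - n%:Z by move/eqP: kn; lia.
    by apply: esym; near: y; exact: near_letter.
  by apply: esym; near: y; exact: near_letter.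
near=> y => k Nk kN.
have : (absz k < (absz N).+1)%N by lia.
by move: k {Nk kN}; near: y; exact: H.
Unshelve. all: by end_near. Qed.

Local Notation no02 := (vertex_shift no02_matrix).

Lemma no02_admissible (x : set_type no02) : admissible (set_val x).
Proof. by apply/vertex_shift_no02P; exact: set_valP. Qed.

Arguments no02_admissible : clear implicits.

Definition no02_of (y : int -> 'I_3) (ay : admissible y) : set_type no02 :=
  exist _ (y : full_shift _) (mem_set (proj2 (vertex_shift_no02P y) ay)).

Lemma no02_cvg (T : topologicalType) (u : T -> set_type no02) (t : T) :
  (forall j, \forall s \near t, set_val (u s) j = set_val (u t) j) -> u @ t --> u t.
Proof.
move=> H U [V [[W oW <-] Wu WU]].
have K : \forall s \near t, W (set_val (u s)).
  exact: (@full_shift_cvg _ _ (set_val \o u) t H W (open_nbhs_nbhs (conj oW Wu))).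
suff : \forall s \near t, U (u s) by [].
by apply: filterS K => s Ws; exact: WU.
Qed.

Lemma set_val_continuous : continuous (set_val : set_type no02 -> full_shift _).
Proof. exact: initial_continuous. Qed.

Lemma near_no02 (x : set_type no02) N : \forall y \near x, agree_upto N (set_val x) (set_val y).
Proof. exact: (@set_val_continuous x _ (near_agree_upto (set_val x) N)). Qed.

(** * The time map is continuous *)

Lemma incr_surj_continuous (R : realType) (a : R -> R) :
  {homo a : t s / t < s} -> (forall s, exists t, a t = s) -> continuous a.
Proof.
move=> a_lt a_surj t; apply/cvgrPdist_le => e e0.
have [t1 t1E] := a_surj (a t - e); have [t2 t2E] := a_surj (a t + e).
have a_reflect r s : a r < a s -> r < s.
  move=> ars; rewrite ltNge le_eqVlt; apply/negP => /orP[/eqP E|/a_lt]; last by lra.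
  by move: ars; rewrite E ltxx.
have lt1 : t1 < t by apply: a_reflect; lra.
have lt2 : t < t2 by apply: a_reflect; lra.
near=> s; have : s \in `]t1, t2[ by near: s; apply: near_in_itvoo; rewrite in_itv/= lt1.
rewrite in_itv/= => /andP[/a_lt s1 /a_lt s2]; rewrite ler_norml; apply/andP; split; lra.
Unshelve. all: by end_near. Qed.

Section TimeContinuity.
Variable R : realType.
Variables (f g : cantor_space -> cantor_space).
Hypothesis Hf : prefix_exchange f.
Hypothesis Hg : prefix_exchange g.
Hypothesis gK : cancel g f.
Hypothesis fK : cancel f g.

(** A preimage is provided by the inverse g, once the origin is moved to a
    marker so that retime_comp applies. *)
Lemma retime_surj x (s : R) : admissible x -> exists t, retime f x t = s.
Proof.
move=> ax; case: (pselect (exists m, marked x m)) => [[m xm]|N]; last first.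
  by exists s; apply: retime_unmarked => m; apply/negP => xm; apply: N; exists m.
pose x' := shiftz m (x : full_shift _).
have ax' : admissible x' by move=> i /ax; rewrite /marked /x' /shiftz addrAC.
have x0' : marked x' 0 by rewrite /marked /x' /shiftz add0r.
have gfE : g \o f = id by apply/funext => z /=; rewrite fK.
have fgE : f \o g = id by apply/funext => z /=; rewrite gK.
pose y := recode f x'; have ay : admissible y by exact: admissible_recode.
have y0 : marked y 0 by rewrite -(pos0 f x'); exact: marked_recode.
have ey : recode g y = x' by rewrite /y recode_comp// gfE recode_id.
pose s' := s - (pos f x m)%:~R.
have := retime_comp s' Hf Hg ay y0; rewrite ey fgE retime_id => h.
exists (retime g y s' + m%:~R); have := retime_shift f m x (retime g y s' + m%:~R).
by rewrite addrK h /s' => /addIr/esym.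
Qed.

Lemma retime_continuous x : admissible x -> continuous (retime f x : R -> R).
Proof.
by move=> ax; apply: incr_surj_continuous; [exact: retime_lt|move=> s; exact: retime_surj].
Qed.

(** Near x the time map is the one of x, for all times near t at once. Joint
    continuity thus reduces to continuity in the time alone. *)
Lemma retime_near_local (x : set_type no02) (t : R) :
  \forall p \near (x, t), retime f (set_val p.1) p.2 = retime f (set_val x) p.2.
Proof.
have [n [G HG]] := prefix_ruleP Hf; have ax := no02_admissible x.
(* the marker is sought before t - 1 to serve all times near t *)
have [N [NE anchor]] : exists N : int, `|t| + 1 + n%:R + 3 <= N%:~R /\
    ((exists M, [/\ - N <= M, M%:~R <= t - 1 & marked (set_val x) M]) \/
     (forall m, marked (set_val x) m -> t - 1 < m%:~R)).
  pose N0 := Num.ceil (`|t| + 1 + n%:R + 3).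
  have N0E : `|t| + 1 + n%:R + 3 <= N0%:~R :> R by exact: ceil_ge.
  case: (pselect (exists2 M, M%:~R <= t - 1 & marked (set_val x) M)) => [[M Mt xM]|no].
    exists (Num.max N0 (- M)); split; first by apply: le_trans N0E _; rewrite ler_int le_max lexx.
    by left; exists M; split => //; rewrite lerNl le_max lexx orbT.
  exists N0; split => //; right => m xm; rewrite ltNge; apply/negP => mt.
  by apply: no; exists m.
have near1 : \forall p \near (x, t), agree_upto N (set_val x) (set_val p.1).
  exact: (@cvg_fst _ _ (nbhs x) (nbhs t) _ _ (near_no02 x N)).
have near2 : \forall p \near (x, t), `|t - p.2| < 1.
  have H : \forall s \near t, `|t - s| < 1.
    by have /cvgrPdist_lt := @cvg_id _ (nbhs t); apply.
  exact: (@cvg_snd _ _ (nbhs x) (nbhs t) _ _ H).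
apply: filterS2 near1 near2 => -[y s] /= xy ts.
have ay := no02_admissible y.
have st : t - 1 < s by move: ts; rewrite ltr_norml => /andP[]; lra.
apply/esym/(@retime_local _ _ n G _ _ N _ HG ax ay xy).
  apply: le_trans NE; rewrite lerD2r lerD2r.
  by have := ler_normB t (t - s); rewrite subKr; lra.
case: anchor => [[M [NM Mt xM]]|nM].
  by left; exists M; split => //; lra.
case: (pselect (exists2 m, m%:~R <= s & marked (set_val x) m)) => [[m ms xm]|no].
  left; exists m; split => //; have := nM _ xm => mt.
  have tb : - `|t| <= t by rewrite lerNl -normrN ler_norm.
  rewrite -(ler_int R) mulrNz; have : 0 <= n%:R :> R by [].
  lra.
by right => m xm; rewrite ltNge; apply/negP => ms; apply: no; exists m.
Qed.

End TimeContinuity.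

(** * The action on the mapping torus *)

Section Action.
Variable R : realType.
Local Notation SX := (mapping_torus R no02).
Implicit Types (v w : thompsonV) (x : set_type no02) (t : R) (p : SX).

Lemma thompsonV_prefix v : prefix_exchange (val v).
Proof. exact/asboolP/(valP v). Qed.

Definition recode_no02 v x : set_type no02 :=
  no02_of (admissible_recode (thompsonV_prefix v) (no02_admissible x)).

Definition lift v (q : set_type no02 * R) : SX :=
  torus_class (recode_no02 v q.1) (retime (val v) (set_val q.1) q.2).

Definition act v p : SX := lift v (repr p).

Lemma actE v x t :
  act v (torus_class x t) = torus_class (recode_no02 v x) (retime (val v) (set_val x) t).
Proof.
rewrite /act /lift; set q := repr _.
have /torus_classP [n [e1 e2]] : torus_class q.1 q.2 = torus_class x t.
  exact: torus_class_repr.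
apply/torus_classP; exists (pos (val v) (set_val q.1) n); split.
  have -> : set_val (recode_no02 v x) = recode (val v) (set_val x) by [].
  rewrite e1; apply/funext => j.
  by rewrite recode_shift//; exact: no02_admissible.
by rewrite e1 e2 retime_shift.
Qed.

Lemma set_val_inj x y : set_val x = set_val y -> x = y.
Proof. exact: val_inj. Qed.

(** Composition is exact at sequences with a marker at the origin, and every
    point is represented by one unless its orbit has no marker at all. *)
Lemma torus_marked p :
  (exists x t, p = torus_class x t /\ marked (set_val x) 0) \/
  (exists x t, p = torus_class x t /\ forall m, ~~ marked (set_val x) m).
Proof.
rewrite -[p]torus_class_repr; move: (repr p).1 (repr p).2 => x t.
have ax := no02_admissible x.
case: (pselect (exists m, marked (set_val x) m)) => [[m xm]|N]; last first.
  by right; exists x, t; split => // m; apply/negP => xm; apply: N; exists m.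
have ax' : admissible (shiftz m (set_val x)) by move=> i /ax; rewrite /marked /shiftz addrAC.
left; exists (no02_of ax'), (t - m%:~R); split; last first.
  by have : marked (shiftz m (set_val x)) 0 by rewrite /marked /shiftz add0r.
by apply/torus_classP; exists m.
Qed.

Lemma act_mul v w p : act v (act w p) = act (v * w)%g p.
Proof.
have Hv := thompsonV_prefix v; have Hw := thompsonV_prefix w.
case: (torus_marked p) => -[x [t [-> x0]]]; rewrite !actE; have ax := no02_admissible x.
  congr torus_class; first by apply: set_val_inj => /=; exact: recode_comp.
  exact: retime_comp.
have im u : recode_no02 u x = x by apply: set_val_inj; exact: recode_unmarked.
by rewrite !im !retime_unmarked.
Qed.

Lemma act1 p : act 1%g p = p.
Proof.
rewrite -[p]torus_class_repr actE retime_id; congr torus_class.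
by apply: set_val_inj => /=; apply: recode_id; exact: no02_admissible.
Qed.

Lemma actK v : cancel (act v) (act v^-1%g).
Proof. by move=> p; rewrite act_mul mulVg act1. Qed.

Lemma actVK v : cancel (act v^-1%g) (act v).
Proof. by move=> p; rewrite act_mul mulgV act1. Qed.

Lemma recode_no02_continuous v : continuous (recode_no02 v).
Proof.
move=> x; apply: no02_cvg => j; have ax := no02_admissible x.
have [N HN] := recode_local j (thompsonV_prefix v) ax.
by apply: filterS (near_no02 x N) => y xy; apply: HN => //; exact: no02_admissible.
Qed.

Lemma thompsonV_VK v : cancel (val v^-1%g) (val v).
Proof. exact: homeoVK. Qed.

Lemma thompsonV_K v : cancel (val v) (val v^-1%g).
Proof. exact: homeoK. Qed.

Lemma retime_continuous2 v :
  continuous (fun q : set_type no02 * R => retime (val v) (set_val q.1) q.2 : R).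
Proof.
move=> [x t]; have Hv := thompsonV_prefix v; have Hv' := thompsonV_prefix v^-1%g.
have c1 : (fun q : set_type no02 * R => retime (val v) (set_val x) q.2 : R) @ (x, t) -->
    (retime (val v) (set_val x) t : R).
  apply: (@cvg_comp _ _ _ snd (retime (val v) (set_val x))); first exact: cvg_snd.
  exact: (retime_continuous Hv Hv' (@thompsonV_VK v) (@thompsonV_K v) (no02_admissible x)).
apply: cvg_trans c1; apply: near_eq_cvg.
by apply: filterS (retime_near_local Hv x t) => -[y s] /= ->.
Qed.

Lemma act_continuous v : continuous (act v).
Proof.
apply/quotient_continuous.
have -> : act v \o (\pi_SX)%qT =
    (\pi_SX)%qT \o (fun q => (recode_no02 v q.1, retime (val v) (set_val q.1) q.2)).
  by apply/funext => -[x t]; exact: actE.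
move=> q; apply: continuous_comp; last exact: pi_continuous.
apply: (@cvg_pair _ _ _ _ (nbhs (recode_no02 v q.1)) (nbhs (retime (val v) (set_val q.1) q.2))).
  by apply: (@cvg_comp _ _ _ fst (recode_no02 v)); [exact: cvg_fst|exact: recode_no02_continuous].
exact: retime_continuous2.
Qed.

Definition act_homeo v : homeo SX :=
  Homeo (@act_continuous v) (@act_continuous v^-1%g) (@actK v) (@actVK v).

Lemma incr_surj_homeo (a : R -> R) :
  {homo a : t s / t < s} -> (forall s, exists t, a t = s) ->
  exists b : homeo R, b =1 a.
Proof.
move=> a_lt a_surj; pose b s := projT1 (cid (a_surj s)).
have ab : cancel b a by move=> s; rewrite /b; case: cid.
have a_inj : injective a.
  by move=> t s e; case: (ltgtP t s) => // /a_lt; rewrite e ltxx.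
have ba : cancel a b by move=> t; apply: a_inj; rewrite ab.
have b_lt : {homo b : t s / t < s}.
  move=> t s ts; rewrite ltNge le_eqVlt; apply/negP => /orP[/eqP E|/a_lt].
    by move: ts; rewrite -[t]ab -E ab ltxx.
  by rewrite !ab; lra.
have a_cont := incr_surj_continuous a_lt a_surj.
have b_cont : continuous b by apply: incr_surj_continuous => // t; exists (a t).
by exists (Homeo a_cont b_cont ba ab).
Qed.

(** Along each flow line the action is an increasing bijection of the line,
    and such a map is a homeomorphism. *)
Lemma act_orientation v : orientation_preserving (act_homeo v).
Proof.
move=> p; rewrite -[p]torus_class_repr; move: (repr p).1 (repr p).2 => x t.
have ax := no02_admissible x.
have Hv := thompsonV_prefix v; have Hv' := thompsonV_prefix v^-1%g.
pose a r := retime (val v) (set_val x) (t + r) - retime (val v) (set_val x) t.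
have a_lt : {homo a : r s / r < s}.
  by move=> r s rs; rewrite /a ltrD2r; apply: retime_lt => //; rewrite ltrD2l.
have a_surj s : exists r, a r = s.
  have [r rE] := retime_surj Hv Hv' (@thompsonV_VK v) (@thompsonV_K v)
    (s + retime (val v) (set_val x) t) ax.
  by exists (r - t); rewrite /a (addrC t) subrK rE addrK.
have [b bE] := incr_surj_homeo a_lt a_surj.
exists b; split => [r s|r].
  by rewrite !bE; apply/idP/idP; [rewrite !leNgt; apply/contra/a_lt|exact: ltW_homo].
rewrite bE flowE /= !actE flowE; congr torus_class.
by rewrite /a subrKC.
Qed.

Definition actF v : Fgroup R no02 :=
  exist _ (act_homeo v) (introT (asboolP _) (@act_orientation v)).

Lemma actF_mul v w : actF (v * w)%g = (actF v * actF w)%g.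
Proof. by apply/val_inj/homeo_ext => p; rewrite /= act_mul. Qed.

End Action.

(** * Paths in the mapping torus *)

Lemma locally_constant (R : realType) (E : set R) (P : R -> Prop) :
  is_interval E -> open E -> (forall t, E t -> \forall s \near t, P s <-> P t) ->
  forall t s, E t -> E s -> P t -> P s.
Proof.
move=> /connected_intervalP cE oE lc t s Et Es Pt.
have open_part (Q : R -> Prop) : (forall t, E t -> \forall s \near t, Q s <-> Q t) ->
    open [set r | E r /\ Q r].
  move=> lQ; rewrite openE => r [Er Qr].
  near=> u; split; first by near: u; exact: open_nbhs_nbhs.
  by have [_] : Q u <-> Q r by [near: u; exact: lQ]; apply.
suff BE : [set r | E r /\ P r] = E.
  by have : [set r | E r /\ P r] s by [rewrite BE]; case.
apply: cE; first by exists t.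
  by exists [set r | E r /\ P r]; [exact: open_part|apply/seteqP; split => r /= [] // _ []].
exists (~` [set r | E r /\ ~ P r]).
  apply: open_closedC; apply: (open_part (fun r => ~ P r)) => r Er.
  by apply: filterS (lc r Er) => u [h1 h2]; split => nP; move=> h; apply: nP; auto.
apply/seteqP; split => r /= [Er Pr]; split => //; first by case.
by apply: contrapT => nP; apply: Pr.
Unshelve. all: by end_near. Qed.

Section Paths.
Variable R : realType.
Local Notation SX := (mapping_torus R no02).

Definition same_orbit (p q : SX) : Prop := exists r : R, q = flow r p.

Lemma flow0 (p : SX) : flow 0 p = p.
Proof. by rewrite -{1}[p]torus_class_repr flowE addr0 torus_class_repr. Qed.

Lemma flowD (r s : R) (p : SX) : flow r (flow s p) = flow (s + r) p.
Proof. by rewrite -[p]torus_class_repr !flowE addrA. Qed.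

Lemma same_orbit_sym p q : same_orbit p q -> same_orbit q p.
Proof. by move=> [r ->]; exists (- r); rewrite flowD subrr flow0. Qed.

Lemma same_orbit_trans q p r : same_orbit p q -> same_orbit q r -> same_orbit p r.
Proof. by move=> [a ->] [b ->]; exists (a + b); rewrite flowD. Qed.

(** A piece of a flow box. The width 1 in the flow direction makes the
    transversal sequence x unique (see chart_inj). *)
Definition box (i : int) (C : pred 'I_3) (s0 : R) : set SX :=
  [set p | exists x s, [/\ p = torus_class x s, C (set_val x i) & `|s - s0| < 2^-1]].

Lemma box_open i C s0 : open (box i C s0).
Proof.
suff H : open ((\pi_SX)%qT @^-1` box i C s0) by exact: H.
rewrite openE => -[y u] /= [x [s [e Cx ss0]]].
have /torus_classP [n [xE sE]] : torus_class y u = torus_class x s by exact: e.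
have near1 : \forall q \near (y, u), set_val q.1 (i + n) = set_val y (i + n).
  have H : \forall y' \near y, set_val y' (i + n) = set_val y (i + n).
    exact: (@set_val_continuous y _ (near_letter (set_val y) (i + n))).
  exact: (@cvg_fst _ _ (nbhs y) (nbhs u) _ _ H).
have near2 : \forall q \near (y, u), `|q.2 - n%:~R - s0| < 2^-1.
  have e0 : 0 < 2^-1 - `|s - s0| by rewrite subr_gt0.
  have H : \forall v \near u, `|u - v| < 2^-1 - `|s - s0|.
    by have /cvgrPdist_lt := @cvg_id _ (nbhs u); apply.
  have K : \forall q \near (y, u), `|u - q.2| < 2^-1 - `|s - s0|.
    exact: (@cvg_snd _ _ (nbhs y) (nbhs u) _ _ H).
  apply: filterS K => -[y' v] /= uv.
  have := ler_normD (s - s0) (v - u); rewrite (distrC v).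
  by rewrite (_ : s - s0 + (v - u) = v - n%:~R - s0); [lra|rewrite sE; lra].
apply: filterS2 near1 near2 => -[y' v] /= y'E vs0.
have ay := no02_admissible y'.
have ay' : admissible (shiftz n (set_val y')) by move=> k /ay; rewrite /marked /shiftz addrAC.
exists (no02_of ay'), (v - n%:~R); split => //; first by apply/torus_classP; exists n.
suff -> : set_val (no02_of ay') i = set_val x i by [].
by rewrite xE [LHS]y'E.
Qed.

Lemma chart_inj (s0 : R) (x x' : set_type no02) (s s' : R) :
  torus_class x s = torus_class x' s' -> `|s - s0| < 2^-1 -> `|s' - s0| < 2^-1 -> x = x'.
Proof.
move=> /torus_classP [n [xE ->]]; rewrite !ltr_norml => /andP[h1 h2] /andP[h3 h4].
have n1 : n%:~R < (1 : int)%:~R :> R by rewrite /=; lra.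
have n2 : (-1 : int)%:~R < n%:~R :> R by rewrite mulrNz /=; lra.
rewrite !ltr_int in n1 n2; apply: set_val_inj.
by rewrite xE (_ : n = 0); [apply/funext => k; rewrite /shiftz addr0|lia].
Qed.

(** While a path stays in a flow box, each letter of its transversal sequence
    is locally constant, hence constant. *)
Lemma path_locally_orbit (c : R -> SX) (t0 : R) : continuous c ->
  \forall t \near t0, same_orbit (c t0) (c t).
Proof.
move=> cc; have cE := torus_class_repr (c t0).
move: (repr (c t0)).1 (repr (c t0)).2 cE => x0 s0 cE.
have near_box i C t : box i C s0 (c t) -> \forall u \near t, box i C s0 (c u).
  by move=> bt; apply: cc; apply: open_nbhs_nbhs; split => //; exact: box_open.
have b0 (C : pred 'I_3) : C (set_val x0 0) -> box 0 C s0 (c t0).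
  by move=> Cx; exists x0, s0; rewrite subrr normr0 cE; split => //; lra.
have /nbhs_ballP [e /= e0 He] : \forall t \near t0, box 0 predT s0 (c t).
  exact/near_box/b0.
pose E := ball t0 e.
have itvE : is_interval E by rewrite /E ball_itv; exact: interval_is_interval.
have oE : open E by exact: ball_open.
have E0 : E t0 by exact: ballxx.
have letters t i : E t -> box i (pred1 (set_val x0 i)) s0 (c t).
  move=> Et; pose P t := box i (pred1 (set_val x0 i)) s0 (c t).
  apply: (@locally_constant _ E P itvE oE _ t0 t) => //.
    move=> {Et} {}t Et; have [x [s [ctE _ ss0]]] := He _ Et.
    case: (eqVneq (set_val x i) (set_val x0 i)) => [e1|ne].
      have bt : box i (pred1 (set_val x0 i)) s0 (c t) by exists x, s; split => //=; exact/eqP.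
      by apply: filterS (near_box _ _ _ bt) => u bu; split.
    have bt : box i (predC1 (set_val x0 i)) s0 (c t) by exists x, s; split.
    apply: filterS (near_box _ _ _ bt) => u [y [r [yE /= ny rs]]].
    split => -[y' [r' [y'E /= /eqP e' rs']]].
      by move: ny; rewrite (chart_inj (etrans (esym yE) y'E) rs rs') e' eqxx.
    by move: ne; rewrite (chart_inj (etrans (esym ctE) y'E) ss0 rs') e' eqxx.
  by exists x0, s0; rewrite subrr normr0 cE; split => //=; lra.
exists e => //= t Et; have [x [s [ctE _ ss0]]] := He _ Et.
have -> : c t = torus_class x0 s.
  rewrite ctE; congr torus_class; apply/set_val_inj/funext => i.
  have [y [r [yE /= /eqP <- rs]]] := letters t i Et.
  by rewrite (chart_inj (etrans (esym ctE) yE) ss0 rs).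
by exists (s - s0); rewrite -cE flowE subrKC.
Qed.

(** By path_locally_orbit the orbit of c s is a locally constant function of s. *)
Lemma path_orbit (c : R -> SX) : continuous c -> forall t s, same_orbit (c t) (c s).
Proof.
move=> cc t s.
apply: (@locally_constant _ setT (fun s => same_orbit (c t) (c s)) _ _ _ t s) => //.
- exact: openT.
- move=> r _; apply: filterS (path_locally_orbit r cc) => u ru; split => h.
    by apply: same_orbit_trans h _; exact: same_orbit_sym.
  exact: same_orbit_trans h ru.
- by exists 0; rewrite flow0.
Qed.

(** The retraction of the line onto [0, 1], by which an isotopy gives paths
    indexed by the whole line. *)
Definition clamp (t : R) : R := (`|t| - `|t - 1| + 1) / 2.

Lemma clamp_continuous : continuous clamp.
Proof.
move=> t; apply: cvgMl; apply: cvgD; last exact: cvg_cst.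
apply: cvgB; apply: cvg_norm; first exact: cvg_id.
by apply: cvgB; [exact: cvg_id|exact: cvg_cst].
Qed.

Lemma clamp_itv t : clamp t \in `[0, 1].
Proof.
rewrite in_itv /= /clamp.
by case: (ger0P t) => ?; case: (ger0P (t - 1)) => ?; apply/andP; split; lra.
Qed.

Lemma clamp0 : clamp 0 = 0.
Proof. by rewrite /clamp normr0 [0 - 1]sub0r normrN normr1 sub0r addNr mul0r. Qed.

Lemma clamp1 : clamp 1 = 1.
Proof. by rewrite /clamp subrr normr0 normr1 subr0 -mulr2n divff. Qed.

Lemma isotopic_orbit (f g : Fgroup R no02) p : isotopic f g -> same_orbit (val f p) (val g p).
Proof.
move=> [h [/subspace_continuousP ch h0 h1 _]].
have cl (t : R) : cylinder (clamp t, p) by split => //; exact: clamp_itv.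
have cc : continuous (fun t => h (clamp t, p)).
  move=> t B nB; have := ch _ (cl t) _ nB; rewrite /nbhs/= /within/= => nD.
  have cu : (fun t => (clamp t, p)) @ t --> (clamp t, p).
    apply: (@cvg_pair _ _ _ (nbhs t) (nbhs (clamp t)) (nbhs p) _ _ _ clamp (fun=> p)).
      exact: clamp_continuous.
    exact: cvg_cst.
  have K : \forall s \near t, cylinder ((clamp s, p) : R * SX) -> B (h (clamp s, p)).
    exact: cu nD.
  suff : \forall s \near t, B (h (clamp s, p)) by [].
  by apply: filterS K => s; apply; exact: cl.
by have := path_orbit cc 0 1; rewrite clamp0 clamp1 h0 h1.
Qed.

End Paths.

(** * Injectivity *)

(** With a single marker, a shift between two images of such sequences has to
    be trivial; an infinite word can be any z. The letters 1 on the left avoid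
    the forbidden word 02. *)
Definition one_marker (z : cantor_space) : int -> 'I_3 :=
  fun i => match i with
  | Posz 0 => ord_max
  | Posz n.+1 => bit (z n)
  | Negz _ => bit true
  end.

Lemma marked_one_marker z i : marked (one_marker z) i -> i = 0.
Proof. by case: i => [[|n]|n]; rewrite /marked /= ?bit_neq_max. Qed.

Lemma one_marker_admissible z : admissible (one_marker z).
Proof.
case=> [n|n] xi; apply/negP => /marked_one_marker i0; first by lia.
by move: xi => /= /bit_inj.
Qed.

Lemma word_one_marker z : word (one_marker z) 0 = z.
Proof. by apply: wordE => i; rewrite (_ : 0 + 1 + i%:Z = i.+1%:Z)//; lia. Qed.

Section Injectivity.
Variable R : realType.

(** Isotopic maps send each point into one orbit. For the sequence with a
    single marker followed by z the images have a single marker followed by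
    the images of z, so these coincide. *)
Lemma isotopic_act_inj (v w : thompsonV) :
  isotopic (actF R v) (actF R w) -> v = w.
Proof.
move=> iso; apply/val_inj/homeo_ext => z.
have ax := @one_marker_admissible z; set x := one_marker z in ax.
have x0 : marked x 0 by [].
have [r] := isotopic_orbit (torus_class (no02_of ax) 0) iso.
rewrite /= !actE flowE => /torus_classP [n [E _]].
have {}E : recode (val v) x = shiftz n (recode (val w) x : full_shift _) by exact: E.
have Hv := thompsonV_prefix v; have Hw := thompsonV_prefix w.
have /(marked_recodeP ax) [m xm pm] : marked (recode (val w) x) n.
  have := marked_recode (val v) ax x0; rewrite E pos0 /marked /shiftz add0r; exact.
have m0 : m = 0 by exact: marked_one_marker xm.
have n0 : n = 0 by rewrite -pm m0 pos0.
have {}E : recode (val v) x = recode (val w) x.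
  by rewrite E n0; apply/funext => i; rewrite /shiftz addr0.
have := word_recode Hv ax x0; have := word_recode Hw ax x0.
by rewrite E !pos0 word_one_marker => -> ->.
Qed.

End Injectivity.

Definition to_MCG (R : realType) (v : thompsonV) : MCG R no02 := mapping_class (actF R v).

Lemma to_MCG_mul (R : realType) : {morph @to_MCG R : v w / (v * w)%g}.
Proof. by move=> v w; rewrite /to_MCG actF_mul -MCG_mulE. Qed.

HB.instance Definition _ (R : realType) :=
  isMultiplicative.Build thompsonV (MCG R no02) (@to_MCG R) (@to_MCG_mul R).

Theorem theorem1 (R : realType) :
  exists phi : {multiplicative thompsonV -> MCG R (vertex_shift no02_matrix)},
    injective phi.
Proof.
exists (@to_MCG R : {multiplicative _ -> _}) => v w.
by move=> /mapping_classP; exact: isotopic_act_inj.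
Qed.
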